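(* Let $m$ and $t$ be positive integers with $\binom{t-1}{3}\le m\le\binom{t-1}{3}+\binom{t-2}{2}-(t-4)$. Then every $3$-graph $G$ with $m$ edges satisfies $\lambda(G)\le\lambda(C_{3,m})$; that is, $C_{3,m}$ has the largest Lagrangian among all $3$-graphs with $m$ edges.
   Context: A $3$-graph $G$ has vertex set $[n]$ and edge set $E\subseteq[n]^{(3)}$. Colex ordering on $3$-subsets of $\mathbb N$: $A<B$ iff $\max(A\triangle B)\in B$. $C_{3,m}$ is the $3$-graph whose edges are the first $m$ $3$-subsets of $\mathbb N$ in colex order. For $\vec x\in\mathbb R^n$, $\lambda(G,\vec x)=\sum_{i_1i_2i_3\in E}x_{i_1}x_{i_2}x_{i_3}$, and the Lagrangian is $\lambda(G)=\max\{\lambda(G,\vec x):x_i\ge0,\sum_ix_i=1\}$. *)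

(* Defs.v *)
From mathcomp Require Import all_boot all_order all_algebra.
From mathcomp Require Import all_classical all_reals all_analysis.

Set Implicit Arguments.
Unset Strict Implicit.
Unset Printing Implicit Defensive.

Import Order.TTheory GRing.Theory Num.Theory.
Import numFieldNormedType.Exports.

Local Open Scope ring_scope.

Definition triples (n : nat) : {set {set 'I_n}} :=
  [set A : {set 'I_n} | #|A| == 3]%SET.

Definition lagrangian_poly (R : realType) (n : nat) (E : {set {set 'I_n}})
    (x : 'rV[R]_n) : R :=
  \sum_(e in E) \prod_(i in e) x 0 i.

Definition simplex (R : realType) (n : nat) : set 'rV[R]_n :=
  [set x : 'rV[R]_n | (forall i, 0 <= x 0 i) /\ \sum_i x 0 i = 1]%classic.

(* The supremum is a maximum as soon as [0 < n]: see [lagrangian_max]. *)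
Definition lagrangian (R : realType) (n : nat) (E : {set {set 'I_n}}) : R :=
  sup (lagrangian_poly E @` @simplex R n)%classic.

Definition symdiff (n : nat) (A B : {set 'I_n}) : {set 'I_n} :=
  ((A :\: B) :|: (B :\: A))%SET.

(* The maximum of the symmetric difference exists and lies in [B]. *)
Definition colex_lt (n : nat) (A B : {set 'I_n}) : bool :=
  [exists i in B, (i \in symdiff A B) && [forall j in symdiff A B, (j <= i)%N]].

Definition colex_rank (n : nat) (A : {set 'I_n}) : nat :=
  #|[set B in triples n | colex_lt B A]%SET|.

(* The 3-subsets of [{0, ..., n-1}] are the first ['C(n, 3)] 3-subsets of the   *)
(* natural numbers in colex order, so for [m <= 'C(n, 3)] these are the first   *)
(* [m] 3-subsets of the natural numbers.                                        *)
Definition colex_init (n m : nat) : {set {set 'I_n}} :=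
  [set A in triples n | (colex_rank A < m)%N]%SET.

(* [m <= 'C(m.+2, 3)], so [m.+2] vertices are enough for the first [m] triples; *)
(* vertices that lie in no edge do not change the Lagrangian.                   *)
Definition C3 (m : nat) : {set {set 'I_m.+2}} := colex_init m.+2 m.

Lemma continuous_lagrangian_poly (R : realType) (n : nat)
    (E : {set {set 'I_n}}) : continuous (@lagrangian_poly R n E).
Proof.
rewrite /lagrangian_poly.
apply: (continuous_big add_continuous) => e _.
apply: (continuous_big mul_continuous) => i _.
exact: coord_continuous.
Qed.

Lemma simplex_neq0 (R : realType) (n : nat) :
  (0 < n)%N -> (@simplex R n !=set0)%classic.
Proof.
move=> n_gt0; pose i0 := Ordinal n_gt0.
exists (\row_i (i == i0)%:R); split=> [i|]; first by rewrite mxE ler0n.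
rewrite (bigD1 i0) //= mxE eqxx big1 ?addr0 // => i /negbTE ni0.
by rewrite mxE ni0.
Qed.

Lemma simplex_compact (R : realType) (n : nat) : compact (@simplex R n).
Proof.
have cI : compact [set v : 'rV[R]_n | forall i, v ord0 i \in `[0, 1]%R]%classic.
  have H := @rV_compact R n (fun=> [set` `[0, 1]%R]%classic).
  by apply: H => _; exact: segment_compact.
apply: subclosed_compact cI _; last first.
  move=> x [x0 x1] i /=; rewrite in_itv /= x0 /=.
  by rewrite -x1 (bigD1 i) //= lerDl sumr_ge0.
rewrite (_ : @simplex R n =
  (\bigcap_(i in [set: 'I_n]) [set x : 'rV[R]_n | 0 <= x 0 i] `&`
   [set x : 'rV[R]_n | \sum_i x 0 i = 1])%classic); last first.
  apply/seteqP; split=> x /= [x0 x1]; split=> // i; [by move=> _; exact: x0|].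
  exact: x0.
apply: closedI.
  apply: closed_bigI => i _.
  apply: (@preimage_closed _ _ (fun x : 'rV[R]_n => x 0 i) [set y | 0 <= y]%classic).
    by move=> x _; exact: coord_continuous.
  exact: closed_ge.
apply: (@preimage_closed _ _ (fun x : 'rV[R]_n => \sum_i x 0 i) [set y | y = 1]%classic).
  move=> x _; apply: (continuous_big add_continuous) => i _.
  exact: coord_continuous.
exact: closed_eq.
Qed.

Lemma lagrangian_max (R : realType) (n : nat) (E : {set {set 'I_n}}) :
  (0 < n)%N ->
  exists2 x, @simplex R n x &
    lagrangian_poly E x = lagrangian R E /\
    forall y, @simplex R n y -> lagrangian_poly E y <= lagrangian_poly E x.
Proof.
move=> n_gt0.
have [|x xS xmax] := @compact_EVT_max _ R (@lagrangian_poly R n E) _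
  (simplex_neq0 R n_gt0) (@simplex_compact R n).
  by apply: continuous_subspaceT; exact: continuous_lagrangian_poly.
rewrite inE in xS; exists x => //.
have {}xmax y : simplex y -> lagrangian_poly E y <= lagrangian_poly E x.
  by move=> yS; apply: xmax; rewrite inE.
split=> //; apply/eqP; rewrite eq_le; apply/andP; split.
  apply: ub_le_sup; last by exists x.
  by exists (lagrangian_poly E x) => _ [y yS <-]; exact: xmax.
apply: ge_sup; first by exists (lagrangian_poly E x), x.
by move=> _ [y yS <-]; exact: xmax.
Qed.

Lemma in_symdiff n (A B : {set 'I_n}) i : (i \in symdiff A B) = ((i \in A) != (i \in B)).
Proof. by rewrite !inE; case: (i \in A); case: (i \in B). Qed.

Lemma colex_ltP n (A B : {set 'I_n}) :
  reflect (exists i : 'I_n, [/\ i \in B, i \notin A &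
    forall j : 'I_n, (i < j)%N -> (j \in A) = (j \in B)]) (colex_lt A B).
Proof.
apply: (iffP exists_inP) => [[i iB /andP[iD /forall_inP iM]]|[i [iB niA iE]]].
  exists i; split=> //; first by move: iD; rewrite in_symdiff iB eqb_id; case: (i \in A).
  move=> j ij; apply/eqP; apply: contraTT ij => jD.
  by rewrite -leqNgt; apply: iM; rewrite in_symdiff.
exists i => //; rewrite in_symdiff iB (negbTE niA) /=.
apply/forall_inP => j; rewrite in_symdiff leqNgt.
by apply: contraNN => /iE ->.
Qed.

Lemma colex_lt_irr n (A : {set 'I_n}) : colex_lt A A = false.
Proof. by apply/colex_ltP => -[i [-> ]]. Qed.

Lemma colex_lt_trans n (A B C : {set 'I_n}) : colex_lt A B -> colex_lt B C -> colex_lt A C.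
Proof.
move=> /colex_ltP[i [iB niA iE]] /colex_ltP[j [jC njB jE]]; apply/colex_ltP.
case: (ltngtP i j) => [ij|ji|/val_inj ij].
- exists j; split=> [//||k jk]; first by rewrite (iE _ ij).
  by rewrite (iE _ (ltn_trans ij jk)) jE.
- exists i; split=> [||k ik]; [by rewrite -(jE _ ji)|by []|].
  by rewrite (iE _ ik) (jE _ (ltn_trans ji ik)).
- by move: njB; rewrite -ij iB.
Qed.

Lemma colex_lt_total n (A B : {set 'I_n}) : A != B -> colex_lt A B || colex_lt B A.
Proof.
move=> nAB; have [i0 i0D] : exists i, i \in symdiff A B.
  apply/existsP; apply: contraNT nAB => /existsPn AB; apply/eqP/setP => i.
  by apply/eqP; have := AB i; rewrite in_symdiff negbK.
case: (@arg_maxnP _ i0 (fun i => i \in symdiff A B) (fun i : 'I_n => i : nat) i0D).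
move=> i iD iM; have iE (j : 'I_n) : (i < j)%N -> (j \in A) = (j \in B).
  move=> ij; apply/eqP; apply: contraTT ij => jD.
  by rewrite -leqNgt; apply: iM; rewrite in_symdiff.
move: iD; rewrite in_symdiff; case iA: (i \in A); case iB: (i \in B) => // _.
  apply/orP; right; apply/colex_ltP; exists i.
  by split=> [||j /iE]; rewrite ?iA ?iB.
apply/orP; left; apply/colex_ltP; exists i.
by split=> [||j /iE]; rewrite ?iA ?iB.
Qed.

Lemma card_triples n : #|triples n| = 'C(n, 3).
Proof. by rewrite card_draws card_ord. Qed.

Lemma colex_rank_lt n (A B : {set 'I_n}) :
  A \in triples n -> colex_lt A B -> (colex_rank A < colex_rank B)%N.
Proof.
move=> AT AB; rewrite /colex_rank; apply/proper_card/properP; split.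
  apply/fintype.subsetP => C; rewrite inE [in X in _ -> X]inE => /andP[-> CA] /=.
  exact: colex_lt_trans CA AB.
by exists A; rewrite inE AT ?AB ?colex_lt_irr.
Qed.

Lemma colex_rank_inj n : {in triples n &, injective (@colex_rank n)}.
Proof.
move=> A B AT BT rAB; apply/eqP; apply: contraT => /colex_lt_total.
by case/orP => /colex_rank_lt; [move/(_ AT)|move/(_ BT)]; rewrite rAB ltnn.
Qed.

Lemma colex_rank_ltC n (A : {set 'I_n}) : A \in triples n -> (colex_rank A < 'C(n, 3))%N.
Proof.
move=> AT; rewrite -card_triples; apply/proper_card/properP; split.
  by apply/fintype.subsetP => C; rewrite inE => /andP[].
by exists A => //; rewrite inE AT colex_lt_irr.
Qed.

Lemma card_colex_init n m : (m <= 'C(n, 3))%N -> #|colex_init n m| = m.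
Proof.
move=> mC; pose rs := [seq colex_rank A | A in triples n].
have rs_uniq : uniq rs.
  rewrite map_inj_in_uniq ?enum_uniq // => A B; rewrite !mem_enum.
  exact: colex_rank_inj.
have rs_sub : {subset rs <= iota 0 'C(n, 3)}.
  move=> _ /mapP[A + ->]; rewrite mem_enum mem_iota /= add0n.
  exact: colex_rank_ltC.
have rsE : perm_eq rs (iota 0 'C(n, 3)).
  apply: uniq_perm; [exact: rs_uniq|exact: iota_uniq|].
  have [|_ rsE //] := uniq_min_size rs_uniq rs_sub.
  by rewrite size_iota size_map -cardE card_triples.
have -> : #|colex_init n m| = count (fun r => (r < m)%N) rs.
  rewrite count_map -size_filter /colex_init cardsE cardE.
  rewrite /enum_mem -filter_predI; congr (size _).
  by apply: eq_filter => A; rewrite /= [LHS]andbC.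
rewrite (permP rsE) -(subnKC mC) iotaD count_cat add0n.
rewrite (eq_in_count (a2 := predT)) => [|r]; last first.
  by rewrite mem_iota => /andP[_ ->].
rewrite count_predT size_iota (eq_in_count (a2 := pred0)) => [|r].
  by rewrite count_pred0 addn0.
by rewrite mem_iota => /andP[mr _]; rewrite ltnNge mr.
Qed.

Lemma card_C3 m : #|C3 m| = m.
Proof.
apply: card_colex_init; elim: m => // m IHm.
by rewrite (binS m.+2 2) -[in leqLHS]addn1 (leq_add IHm) // bin_gt0.
Qed.

(* Main.v *)
(* Writing T = t - 1, every graph G with at most C(T,3) + C(T-2,2) + 1 edges satisfies
   lambda(G) <= lambda(K_T), and K_T is contained in C_{3,m} since C(T,3) <= m.

   Otherwise take (G, x) maximal with k > T positive weights, k least possible, the weights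
   x_0 >= ... >= x_{k-1} > 0 decreasing and G left-compressed.  All links have the same
   value 6 lambda (sums over ordered pairs; vertices are numbered from 0).  Moving the
   weight of vertex j onto vertex i lowers 6 lambda by 6 x_j^2 w_{ij}, w_{ij} being the
   weight of the common link of i and j; as this leaves fewer vertices, w_{ij} > 0, so by
   compression every {0, i, j} is an edge.

   If k >= T + 2, move the weight of the last vertex onto the preceding one, and replace the
   d edges through the last vertex, now worthless, by d triples missing from the first T + 1
   vertices.  That the Lagrangian decreases forces x_{T-2}, ..., x_{k-1} to sum to less than
   x_0; then x_0 > 1 / (T - 1), and the link of 0 is too light.

   If k = T + 1, the same move compares G with K_T, which bounds the weight of the missing
   triples of the first T vertices.  Comparing the links of 0, T - 1 and T, together with
   the number of missing triples, gives a contradiction. *)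

Require Import Defs.
From mathcomp Require Import all_boot all_order all_algebra.
From mathcomp Require Import all_classical all_reals all_analysis.
From mathcomp Require Import perm zify ring lra.

Set Implicit Arguments.
Unset Strict Implicit.
Unset Printing Implicit Defensive.

Import Order.TTheory GRing.Theory Num.Theory.

Local Open Scope ring_scope.

(** * Triples with indices in [nat], and the Lagrangian as a sum over ordered triples *)

Definition triple n (i j l : nat) : {set 'I_n} :=
  [set v : 'I_n | val v \in [:: i; j; l]]%SET.

(* For [G] a set of triples, [adj G i j l] is false as soon as two of the indices coincide
   or one of them is at least [n]. *)
Definition adj n (G : {set {set 'I_n}}) i j l : bool := triple n i j l \in G.

(** With equal weight arguments this is 6 times the Lagrangian polynomial ([tri_lagr]). Three
    separate arguments make it multilinear, so a change of weights is expanded one slot at a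
    time. *)
Definition tri (R : realType) n (g : nat -> nat -> nat -> bool) (x y w : nat -> R) : R :=
  \sum_(i < n) \sum_(j < n) \sum_(l < n) (g i j l)%:R * (x i * y j * w l).

(** For [x = y] and a 3-graph, twice the partial derivative of the Lagrangian polynomial at vertex
    [i]. *)
Definition link (R : realType) n (g : nat -> nat -> nat -> bool) i (x y : nat -> R) : R :=
  \sum_(j < n) \sum_(l < n) (g i j l)%:R * (x j * y l).

Definition colink (R : realType) n (g : nat -> nat -> nat -> bool) i j (x : nat -> R) : R :=
  \sum_(l < n) (g i j l)%:R * x l.

Definition lagr (R : realType) n (G : {set {set 'I_n}}) (x : nat -> R) : R :=
  lagrangian_poly G (\row_(i < n) x i).

Lemma triple_perm12 n i j l : triple n i j l = triple n j i l.
Proof. by apply/setP => v; rewrite !inE orbCA. Qed.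

Lemma triple_perm23 n i j l : triple n i j l = triple n i l j.
Proof. by apply/setP => v; rewrite !inE; congr (_ || _); rewrite orbC. Qed.

Lemma adj12 n (G : {set {set 'I_n}}) i j l : adj G i j l = adj G j i l.
Proof. by rewrite /adj triple_perm12. Qed.

Lemma adj23 n (G : {set {set 'I_n}}) i j l : adj G i j l = adj G i l j.
Proof. by rewrite /adj triple_perm23. Qed.

Lemma triple_ord n (i j l : 'I_n) : triple n i j l = (i |: (j |: [set l]))%SET.
Proof. by apply/setP => v; rewrite !inE -!val_eqE. Qed.

(** A set of three elements leaves no room for the list to shrink, neither by removing duplicates
    nor by dropping indices from [n] on. *)
Lemma card_triple n i j l : #|triple n i j l| = 3%N ->
  [/\ (i < n)%N, (j < n)%N, (l < n)%N & uniq [:: i; j; l]].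
Proof.
move=> c3; have vxE : triple n i j l = [set v : 'I_n | val v \in undup [:: i; j; l]]%SET.
  by apply/setP => v; rewrite [LHS]inE [RHS]inE mem_undup.
have le3 (s : seq nat) : (#|[set v : 'I_n | val v \in s]%SET| <= size [seq a <- s | a < n])%N.
  rewrite cardE -(size_map val); apply: uniq_leq_size.
    by rewrite map_inj_uniq ?enum_uniq //; exact: val_inj.
  by move=> a /mapP[v]; rewrite mem_enum inE mem_filter => vs ->; rewrite vs ltn_ord.
have := le3 (undup [:: i; j; l]); rewrite -vxE c3 => /leq_trans -/(_ _ (size_subseq (filter_subseq _ _))) le_und.
have un : uniq [:: i; j; l] by rewrite -[uniq _]negbK -ltn_size_undup -leqNgt.
have := le3 [:: i; j; l]; rewrite -/(triple n i j l) c3 /=.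
by do 3![case: ifP => /= ?].
Qed.

Lemma adjP n (G : {set {set 'I_n}}) i j l : G \subset triples n -> adj G i j l ->
  [/\ (i < n)%N, (j < n)%N, (l < n)%N & uniq [:: i; j; l]].
Proof. by move=> /fintype.subsetP GT /GT; rewrite inE => /eqP /card_triple. Qed.

Lemma eq_triple n (e : {set 'I_n}) (i j l : 'I_n) : #|e| = 3%N ->
  (e == triple n i j l) = [&& i \in e, j \in e :\ i & l \in e :\ i :\ j]%SET.
Proof.
move=> e3; apply/eqP/and3P => [eE|[ie je le]].
  have [_ _ _] := card_triple (etrans (congr1 (fun A : {set 'I_n} => #|A|) (esym eE)) e3).
  rewrite eE /= !inE !negb_or !andbT !val_eqE !eqxx ?orbT => /andP[/andP[ij il] jl].
  by rewrite [j == i]eq_sym [l == i]eq_sym [l == j]eq_sym ij il jl.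
rewrite triple_ord; apply/eqP; rewrite eq_sym eqEcard; apply/andP; split.
  apply/fintype.subsetP => v; move: je le; rewrite !inE => /andP[_ je] /and3P[_ _ le].
  by case/or3P => /eqP ->.
rewrite e3; move: je le; rewrite !inE => /andP[ji je] /and3P[lj li le].
by rewrite !cardsU1 cards1 !inE [i == j]eq_sym [i == l]eq_sym [j == l]eq_sym (negbTE ji) (negbTE li) (negbTE lj).
Qed.

Lemma prod3 (R : realType) n (e : {set 'I_n}) (x : 'I_n -> R) : #|e| = 3%N ->
  \sum_(i in e) \sum_(j in e :\ i) \sum_(l in e :\ i :\ j) (x i * x j * x l)
    = 6 * \prod_(i in e) x i :> R.
Proof.
move=> e3; transitivity (\sum_(i in e) \sum_(j in e :\ i) \sum_(l in e :\ i :\ j) \prod_(i in e) x i).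
  apply: eq_bigr => i ie; apply: eq_bigr => j je; apply: eq_bigr => l le.
  rewrite (big_setD1 i) //= (big_setD1 j) //= (big_setD1 l) //= mulrA mulrA.
  rewrite big_pred0 ?mulr1 // => v.
  have : #|(e :\ i :\ j :\ l)%SET| = 0%N.
    by have := cardsD1 i e; have := cardsD1 j (e :\ i)%SET; have := cardsD1 l (e :\ i :\ j)%SET; rewrite ie je le e3; lia.
  by move/cards0_eq => ->; rewrite inE.
transitivity (\sum_(i in e) \sum_(j in e :\ i)  \prod_(i in e) x i).
  apply: eq_bigr => i ie; apply: eq_bigr => j je; rewrite sumr_const.
  suff -> : #|(e :\ i :\ j)%SET| = 1%N by [].
  by have := cardsD1 i e; have := cardsD1 j (e :\ i)%SET; rewrite ie je e3; lia.
transitivity (\sum_(i in e) (\prod_(i in e) x i) *+ 2).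
  apply: eq_bigr => i ie; rewrite sumr_const.
  suff -> : #|(e :\ i)%SET| = 2%N by [].
  by have := cardsD1 i e; rewrite ie e3; lia.
by rewrite sumr_const e3 -mulrnA mulr_natl.
Qed.

Lemma tri_lagr (R : realType) n (G : {set {set 'I_n}}) (x : nat -> R) :
  G \subset triples n -> tri n (adj G) x x x = 6 * lagr G x.
Proof.
move=> /fintype.subsetP GT; rewrite /lagr /lagrangian_poly mulr_sumr.
(* Writing adjacency as a sum over edges lets the sums be exchanged, after which each edge collects
   its six orderings. *)
have adjE i j l : (adj G i j l)%:R = \sum_(e in G) (e == triple n i j l)%:R :> R.
  rewrite /adj; case: (boolP (_ \in G)) => vG.
    rewrite (bigD1 (triple n i j l)) //= eqxx big1 ?addr0 // => e /andP[_ /negbTE ->] //.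
  by rewrite big1 // => e eG; case: eqP => // eE; rewrite -eE eG in vG.
transitivity (\sum_(i < n) \sum_(j < n) \sum_(l < n) \sum_(e in G) (e == triple n i j l)%:R * (x i * x j * x l)).
  by apply: eq_bigr => i _; apply: eq_bigr => j _; apply: eq_bigr => l _; rewrite adjE mulr_suml.
under eq_bigr => i _ do (under eq_bigr => j _ do rewrite exchange_big; rewrite exchange_big).
rewrite exchange_big; apply: eq_bigr => e /GT; rewrite inE => /eqP e3.
under [in RHS]eq_bigr do rewrite mxE.
rewrite -(prod3 (fun i : 'I_n => x i) e3) [RHS]big_mkcond; apply: eq_bigr => i _.
case: ifP => ie; last by rewrite big1 // => j _; rewrite big1 // => l _; rewrite eq_triple // ie mul0r.
rewrite [RHS]big_mkcond; apply: eq_bigr => j _.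
case: ifP => je; last by rewrite big1 // => l _; rewrite eq_triple // ie je mul0r.
rewrite [RHS]big_mkcond; apply: eq_bigr => l _.
by rewrite eq_triple // ie je /=; case: ifP; rewrite ?mul1r ?mul0r.
Qed.

Lemma tri_card (R : realType) n (G : {set {set 'I_n}}) : G \subset triples n ->
  tri n (adj G) (fun=> 1) (fun=> 1) (fun=> 1) = 6 * #|G|%:R :> R.
Proof.
move=> GT; rewrite tri_lagr // /lagr /lagrangian_poly; congr (_ * _).
rewrite (eq_bigr (fun=> 1)) ?sumr_const // => e _.
by rewrite big1 // => i _; rewrite mxE.
Qed.

(** * Expansion of the form when weight moves between two vertices *)

Section Multilinear.
Context (R : realType) (n : nat) (g : nat -> nat -> nat -> bool).
Hypothesis g12 : forall i j l, g i j l = g j i l.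
Hypothesis g23 : forall i j l, g i j l = g i l j.
Hypothesis g_irr : forall i l, g i i l = false.
Implicit Types (x y w : nat -> R).

Lemma tri12 x y w : tri n g x y w = tri n g y x w.
Proof.
rewrite /tri exchange_big; apply: eq_bigr => i _; apply: eq_bigr => j _.
by apply: eq_bigr => l _; rewrite g12; ring.
Qed.

Lemma tri23 x y w : tri n g x y w = tri n g x w y.
Proof.
rewrite /tri; apply: eq_bigr => i _; rewrite exchange_big; apply: eq_bigr => j _.
by apply: eq_bigr => l _; rewrite g23; ring.
Qed.

Lemma link_sym i x y : link n g i x y = link n g i y x.
Proof.
rewrite /link exchange_big; apply: eq_bigr => j _.
by apply: eq_bigr => l _; rewrite g23; ring.
Qed.

Definition move_weight (i j : nat) s x (v : nat) : R :=
  x v + s * (v == i)%:R - s * (v == j)%:R.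

Lemma sum_move_weight (i j : nat) s x (f : nat -> R) : (i < n)%N -> (j < n)%N ->
  \sum_(v < n) move_weight i j s x v * f v
    = \sum_(v < n) x v * f v + s * f i - s * f j.
Proof.
have sum1 a : (a < n)%N -> \sum_(v < n) s * (v == a :> nat)%:R * f v = s * f a.
  move=> an; rewrite (bigD1 (Ordinal an)) //= eqxx mulr1 big1 ?addr0 // => v.
  by rewrite -val_eqE /= => /negbTE ->; rewrite mulr0 mul0r.
move=> i_n j_n; rewrite -(sum1 _ i_n) -(sum1 _ j_n) -big_split -sumrB /=.
by apply: eq_bigr => v _; rewrite /move_weight; ring.
Qed.

Lemma tri_move_weight i j s x y w : (i < n)%N -> (j < n)%N ->
  tri n g (move_weight i j s x) y w = tri n g x y w + s * link n g i y w - s * link n g j y w.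
Proof.
move=> i_n j_n.
have triE z : tri n g z y w = \sum_(v < n) z v * link n g v y w.
  apply: eq_bigr => v _; rewrite /link mulr_sumr; apply: eq_bigr => u _.
  by rewrite mulr_sumr; apply: eq_bigr => l _; ring.
by rewrite !triE (sum_move_weight _ _ (fun v => link n g v y w)).
Qed.

Lemma link_move_weight a i j s x y : (i < n)%N -> (j < n)%N ->
  link n g a (move_weight i j s x) y = link n g a x y + s * colink n g a i y - s * colink n g a j y.
Proof.
move=> i_n j_n.
have linkE z : link n g a z y = \sum_(v < n) z v * colink n g a v y.
  by apply: eq_bigr => v _; rewrite /colink mulr_sumr; apply: eq_bigr => u _; ring.
by rewrite !linkE (sum_move_weight _ _ (fun v => colink n g a v y)).
Qed.

Lemma colink_move_weight a b i j s x : (i < n)%N -> (j < n)%N ->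
  colink n g a b (move_weight i j s x) = colink n g a b x + s * (g a b i)%:R - s * (g a b j)%:R.
Proof.
move=> i_n j_n.
have colinkE z : colink n g a b z = \sum_(v < n) z v * (g a b v)%:R.
  by apply: eq_bigr => v _; ring.
by rewrite !colinkE (sum_move_weight _ _ (fun v => (g a b v)%:R)).
Qed.

Lemma colink_sym i j x : colink n g i j x = colink n g j i x.
Proof. by rewrite /colink; apply: eq_bigr => l _; rewrite g12. Qed.

Lemma colink_diag i x : colink n g i i x = 0.
Proof. by rewrite /colink big1 // => l _; rewrite g_irr mul0r. Qed.

(** The polynomial has degree at most one in each variable, so the expansion stops at the mixed term
    of [i] and [j], whose coefficient comes from their common link. *)
Lemma tri_move i j s x : (i < n)%N -> (j < n)%N ->
  tri n g (move_weight i j s x) (move_weight i j s x) (move_weight i j s x)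
   = tri n g x x x + 3 * s * (link n g i x x - link n g j x x) - 6 * s ^+ 2 * colink n g i j x.
Proof.
move=> i_n j_n; set y := move_weight i j s x.
have irr a b : (g a a b = false) * (g a b a = false) * (g b a a = false).
  by rewrite (g12 b) (g23 a b) g_irr.
have liE : link n g i y y = link n g i x x - 2 * s * colink n g i j x.
  rewrite [LHS]link_move_weight // [link n g i x y]link_sym link_move_weight // !colink_move_weight //.
  rewrite !colink_diag !irr /=; ring.
have ljE : link n g j y y = link n g j x x + 2 * s * colink n g i j x.
  rewrite [LHS]link_move_weight // [link n g j x y]link_sym link_move_weight // !colink_move_weight //.
  rewrite !colink_diag !irr (colink_sym j i) /=; ring.
have lixE : link n g i x y = link n g i x x - s * colink n g i j x.
  rewrite link_sym link_move_weight // !colink_diag; ring.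
have ljxE : link n g j x y = link n g j x x + s * colink n g i j x.
  rewrite link_sym link_move_weight // !colink_diag (colink_sym j i); ring.
have t1 : tri n g x x y = tri n g x x x + s * link n g i x x - s * link n g j x x.
  by rewrite tri23 tri12 tri_move_weight.
have t2 : tri n g x y y = tri n g x x y + s * link n g i x y - s * link n g j x y.
  by rewrite tri12 tri_move_weight.
have -> : tri n g y y y = tri n g x y y + s * link n g i y y - s * link n g j y y.
  exact: tri_move_weight.
rewrite t2 t1 lixE ljxE liE ljE.
move: (tri n g x x x) (link n g i x x) (link n g j x x) (colink n g i j x) => t li lj c.
ring.
Qed.

Lemma euler x : tri n g x x x = \sum_(i < n) x i * link n g i x x.
Proof.
apply: eq_bigr => i _; rewrite /link mulr_sumr; apply: eq_bigr => j _.
by rewrite mulr_sumr; apply: eq_bigr => l _; ring.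
Qed.

End Multilinear.

(** * Extremal pairs of a graph and a weighting *)

(** [ex_max] compares with all graphs of at most [m] edges on the same [n] vertices. [ex_min]
    expresses that the support is least possible: a competitor supported on the first [k] vertices
    and vanishing at one of them is strictly worse. [ex_shift] is left-compression, one vertex at a
    time. *)
Record extremal (R : realType) n m (G : {set {set 'I_n}}) k (x : nat -> R) : Prop := Extremal {
  ex_sub : G \subset triples n;
  ex_card : (#|G| <= m)%N;
  ex_dim : (k <= n)%N;
  ex_pos : forall i, (i < k)%N -> 0 < x i;
  ex_zero : forall i, (k <= i)%N -> x i = 0;
  ex_mono : forall i j, (i <= j)%N -> x j <= x i;
  ex_sum : \sum_(i < n) x i = 1;
  ex_max : forall (G' : {set {set 'I_n}}) (y : nat -> R), G' \subset triples n -> (#|G'| <= m)%N ->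
    (forall i, 0 <= y i) -> \sum_(i < n) y i = 1 -> lagr G' y <= lagr G x;
  ex_min : forall (G' : {set {set 'I_n}}) (y : nat -> R) j, G' \subset triples n -> (#|G'| <= m)%N ->
    (forall i, 0 <= y i) -> \sum_(i < n) y i = 1 ->
    (j < k)%N -> y j = 0 -> (forall i, (k <= i)%N -> y i = 0) -> lagr G' y < lagr G x;
  ex_shift : forall i j l l', adj G i j l -> (l' < l)%N -> l' != i -> l' != j ->
    adj G i j l'
}.

Lemma big_triple T (idx : T) (op : Monoid.com_law idx) n (f : nat -> T) i j l :
  (i < n)%N -> (j < n)%N -> (l < n)%N -> uniq [:: i; j; l] ->
  \big[op/idx]_(v in triple n i j l) f v = op (f i) (op (f j) (f l)).
Proof.
move=> i_n j_n l_n; rewrite /= !inE negb_or andbT => /andP[/andP[ij il] jl].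
rewrite (triple_ord (Ordinal i_n) (Ordinal j_n) (Ordinal l_n)).
rewrite big_setU1 /= ?inE -?val_eqE /= ?negb_or ?ij //.
by rewrite big_setU1 /= ?inE -?val_eqE //= big_set1.
Qed.

Lemma exists_sort (R : realType) n (x : 'I_n -> R) :
  exists s : {perm 'I_n}, forall i j : 'I_n, (i <= j)%N -> x (s j) <= x (s i).
Proof.
pose r (i j : 'I_n) := x j <= x i.
pose e := sort r (enum 'I_n).
have r_total : total r by move=> i j; exact: le_total.
have r_trans : transitive r by move=> i j l ij jl; exact: le_trans jl ij.
have r_refl : reflexive r by move=> i; exact: lexx.
have e_size : size e = n by rewrite size_sort size_enum_ord.
have f_inj : injective (fun i : 'I_n => nth i e i).
  move=> i j; rewrite (set_nth_default j) ?e_size // => /eqP.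
  rewrite nth_uniq ?e_size // ?sort_uniq ?enum_uniq // => /eqP; exact: val_inj.
exists (perm f_inj) => i j ij; rewrite !permE (set_nth_default i j) ?e_size //.
by apply: (sorted_leq_nth r_trans r_refl); rewrite ?inE ?e_size //; exact: sort_sorted.
Qed.

Lemma lagrangian_poly_perm (R : realType) n (G : {set {set 'I_n}}) (s : {perm 'I_n}) (x : 'rV[R]_n) :
  lagrangian_poly [set e : {set 'I_n} | (s @: e)%SET \in G]%SET (\row_i x 0 (s i)) = lagrangian_poly G x.
Proof.
rewrite /lagrangian_poly.
rewrite [RHS](reindex_onto (fun e : {set 'I_n} => s @: e)%SET (fun e => s^-1%g @: e)%SET) /=; last first.
  by move=> e _; rewrite -imset_comp (eq_imset _ (permKV s)) imset_id.
apply: eq_big => [e|e _].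
  by rewrite inE -imset_comp (eq_imset _ (permK s)) imset_id eqxx andbT.
rewrite big_imset /=; last by move=> i j _ _; exact: perm_inj.
by apply: eq_bigr => i _; rewrite mxE.
Qed.

(** Three choices in succession: the largest Lagrangian over graphs with at most [m] edges, the
    smallest support among all optimal pairs, and, after sorting the weights, the least index sum
    among the graphs optimal for this weighting. *)
Lemma extremal_exists (R : realType) n m (G0 : {set {set 'I_n}}) : (0 < n)%N ->
  G0 \subset triples n -> (#|G0| <= m)%N ->
  exists (G : {set {set 'I_n}}) k (x : nat -> R), extremal m G k x /\ lagrangian R G0 <= lagr G x.
Proof.
move=> n_gt0 G0T G0m.
pose P (G : {set {set 'I_n}}) := (G \subset triples n) && (#|G| <= m)%N.
have P0 : P G0 by rewrite /P G0T.
case: (@Order.TotalTheory.arg_maxP _ R _ G0 P (@lagrangian R n) P0) => G1 PG1 G1max.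
set L := lagrangian R G1 in G1max.
have Lmax G (y : 'rV[R]_n) : P G -> simplex y -> lagrangian_poly G y <= L.
  move=> PG yS; apply: le_trans (G1max _ PG).
  by have [z zS [<- zmax]] := lagrangian_max R G n_gt0; exact: zmax.
pose supp (y : 'rV[R]_n) := [set i : 'I_n | y 0 i != 0]%SET.
pose Q k := `[< exists G y, [/\ P G, simplex y, lagrangian_poly G y = L & #|supp y| = k] >].
have exQ : exists k, Q k.
  have [z zS [zL _]] := lagrangian_max R G1 n_gt0.
  by exists #|supp z|; apply/asboolP; exists G1, z.
case: (ex_minnP exQ) => k /asboolP[G [y [PG yS yL yk]]] kmin.
have [s ys] := exists_sort (y 0).
pose z := \row_i y 0 (s i) : 'rV[R]_n.
pose G2 := [set e : {set 'I_n} | (s @: e)%SET \in G]%SET.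
have simg (e : {set 'I_n}) : #|(s @: e)%SET| = #|e| by rewrite card_imset //; exact: perm_inj.
have zS : simplex z.
  split=> [i|]; first by rewrite mxE; exact: yS.1.
  rewrite -yS.2 [RHS](reindex_inj (@perm_inj _ s)) /=.
  by apply: eq_bigr => i _; rewrite mxE.
have PG2 : P G2.
  case/andP: PG => /fintype.subsetP GT Gm; apply/andP; split.
    apply/fintype.subsetP => e; rewrite inE => /GT; rewrite !inE simg //.
  apply: leq_trans Gm; rewrite -(card_imset _ (imset_inj (@perm_inj _ s))).
  by apply: subset_leq_card; apply/fintype.subsetP => _ /imsetP[e + ->]; rewrite inE.
have zL2 : lagrangian_poly G2 z = L by rewrite lagrangian_poly_perm.
have zk : #|supp z| = k.
  rewrite -yk -(card_imset _ (@perm_inj _ s)); congr #|pred_of_set _|.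
  apply/setP => i; apply/imsetP/idP => [[j + ->]|iy]; first by rewrite !inE mxE.
  exists (s^-1 i)%g; last by rewrite permKV.
  by rewrite inE mxE permKV; rewrite inE in iy.
(* A graph of least index sum among the optimal ones is left-compressed. *)
pose P3 G := P G && (lagrangian_poly G z == L).
have P32 : P3 G2 by rewrite /P3 PG2 zL2 eqxx.
case: (@arg_minnP _ G2 P3 (fun G => \sum_(e in G) \sum_(i in e) (i : nat))%N P32).
move=> G3 /andP[PG3 /eqP zL3] G3min.
(* Indices from [n] on get weight 0. *)
pose x i := if insub i is Some v then z 0 (v : 'I_n) else 0.
have xE (i : 'I_n) : x i = z 0 i by rewrite /x valK.
have xN i : (n <= i)%N -> x i = 0 by move=> ni; rewrite /x insubN // -leqNgt.
have x_ge0 i : 0 <= x i by rewrite /x; case: insub => // v; exact: zS.1.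
have xmono i j : (i <= j)%N -> x j <= x i.
  move=> ij; have [jn|nj] := ltnP j n; last by rewrite (xN j).
  have i_n := leq_ltn_trans ij jn.
  by rewrite (xE (Ordinal i_n)) (xE (Ordinal jn)) !mxE; exact: ys.
have lagrx H : lagr H x = lagrangian_poly H z.
  by congr lagrangian_poly; apply/rowP => i; rewrite mxE xE.
have winj p (pn : (p <= n)%N) : injective (widen_ord pn).
  by move=> i j /(congr1 val) /= ij; apply: val_inj.
(* The weights decrease, so the support is an initial segment, of length [k] by its size. *)
have suppE : supp z = [set i : 'I_n | (i < k)%N]%SET.
  apply/setP => i; rewrite !inE -xE; apply/idP/idP => [xi|].
    rewrite -zk -(card_ord i.+1) -(card_imset _ (winj _ (ltn_ord i))).
    apply: subset_leq_card; apply/fintype.subsetP => _ /imsetP[j _ ->].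
    rewrite inE -xE gt_eqF //; apply: lt_le_trans (xmono _ i _); last by rewrite /= -ltnS.
    by rewrite lt_def xi x_ge0.
  apply: contraL => /eqP xi; rewrite -leqNgt -zk -(card_ord i).
  rewrite -(card_imset _ (winj _ (ltnW (ltn_ord i)))).
  apply: subset_leq_card; apply/fintype.subsetP => j; rewrite inE -xE => xj.
  have ji : (j < i)%N.
    rewrite ltnNge; apply: contraNN xj => ij.
    by rewrite eq_le x_ge0 andbT -xi; exact: xmono.
  by apply/imsetP; exists (Ordinal ji) => //; apply: val_inj.
exists G3, k, x; split; last first.
  by rewrite lagrx zL3; exact: G1max.
case/andP: (PG3) => G3T G3m.
have kn : (k <= n)%N by rewrite -zk -[leqRHS](card_ord n) max_card.
have xzero i : (k <= i)%N -> x i = 0.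
  move=> ki; have [i_n|] := ltnP i n; last exact: xN.
  have : Ordinal i_n \notin supp z by rewrite suppE inE -leqNgt.
  by rewrite inE negbK -xE => /eqP.
have rowS (w : nat -> R) : (forall i, 0 <= w i) -> \sum_(i < n) w i = 1 ->
    simplex (\row_(i < n) w i).
  by move=> w0 w1; split=> [i|]; [rewrite mxE|rewrite -w1; apply: eq_bigr => i _; rewrite mxE].
split=> //.
- move=> i ik; have i_n := leq_trans ik kn.
  have : Ordinal i_n \in supp z by rewrite suppE inE.
  by rewrite inE -xE lt_def x_ge0 andbT.
- by under eq_bigr do rewrite xE; exact: zS.2.
- move=> G' w G'T G'm w0 w1; rewrite lagrx zL3; apply: Lmax; first by rewrite /P G'T.
  exact: rowS.
- move=> G' w j G'T G'm w0 w1 jk wj wk; rewrite lagrx zL3 lt_def; apply/andP; split; last first.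
    by apply: Lmax; [rewrite /P G'T|exact: rowS].
  apply/negP => /eqP wL.
  have /kmin : Q #|supp (\row_(i < n) w i)|.
    by apply/asboolP; exists G', (\row_(i < n) w i); split=> //; [rewrite /P G'T|exact: rowS].
  apply/negP; rewrite -ltnNge -zk; apply/proper_card/properP.
  have jn := leq_trans jk kn; split; last first.
    by exists (Ordinal jn); rewrite ?suppE inE //= mxE wj eqxx.
  apply/fintype.subsetP => i; rewrite suppE !inE mxE; apply: contraNT.
  by rewrite -leqNgt => /wk ->.
(* If the shifted triple were missing, exchanging [l] for the smaller [l'] would not lower the
   Lagrangian, the weights being decreasing, but would lower the index sum. *)
move=> i j l l' ijl l'l l'i l'j; apply: contraT => nG.
have [i_n j_n l_n un] := adjP G3T ijl.
have l'_n := ltn_trans l'l l_n.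
have un' : uniq [:: i; j; l'].
  move: un; rewrite /= !inE !negb_or !andbT => /andP[/andP[-> _] _].
  by rewrite ![_ == l']eq_sym l'i l'j.
pose e := triple n i j l; pose e' := triple n i j l'.
have e'G : e' \notin (G3 :\ e)%SET by apply: contraNN nG => /setD1P[].
pose G4 := (e' |: (G3 :\ e))%SET.
have PG4 : P G4.
  apply/andP; split.
    apply/fintype.subsetP => f; rewrite inE => /orP[/set1P ->|/setD1P[_]]; last exact: (fintype.subsetP G3T).
    rewrite inE /e' -sum1_card.
    by rewrite (@big_triple _ 0%N addn n (fun=> 1%N)).
  by rewrite cardsU1 e'G add1n -[X in (X <= _)%N]add1n; have := cardsD1 e G3; rewrite [e \in G3]ijl => <-.
have zL4 : lagrangian_poly G4 z = L.
  apply/eqP; rewrite eq_le Lmax //= -zL3 /lagrangian_poly big_setU1 //=.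
  rewrite (big_setD1 e) //= lerD2r.
  under eq_bigr do rewrite -xE; under [leRHS]eq_bigr do rewrite -xE.
  rewrite (@big_triple _ 1 *%R n x) // (@big_triple _ 1 *%R n x) //.
  by rewrite !ler_wpM2l // xmono // ltnW.
have := G3min G4; rewrite /P3 PG4 zL4 eqxx => /(_ isT).
rewrite leqNgt => /negP[]; rewrite big_setU1 //= (big_setD1 e ijl) /= ltn_add2r.
rewrite (@big_triple _ 0%N addn n id) // (@big_triple _ 0%N addn n id) //.
by rewrite !ltn_add2l.
Qed.

(** * The complete pattern, truncation, and recurrences in the number of vertices *)

(** The complete 3-graph on all of [nat], in the same form as [adj G]. *)
Definition distinct3 (i j l : nat) : bool := uniq [:: i; j; l].

Lemma distinct3E i j l : distinct3 i j l = [&& i != j, i != l & j != l].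
Proof. by rewrite /distinct3 /= !inE negb_or andbT andbA. Qed.

Lemma distinct3_12 i j l : distinct3 i j l = distinct3 j i l.
Proof. by rewrite !distinct3E [j == i]eq_sym; case: (i != j) => //=; exact: andbC. Qed.

Lemma distinct3_23 i j l : distinct3 i j l = distinct3 i l j.
Proof. by rewrite !distinct3E [l == j]eq_sym andbCA. Qed.

Lemma distinct3_irr i l : distinct3 i i l = false.
Proof. by rewrite distinct3E eqxx. Qed.

Lemma sum_trunc (R : realType) k n (f : nat -> R) : (k <= n)%N ->
  (forall i, (k <= i)%N -> f i = 0) -> \sum_(i < n) f i = \sum_(i < k) f i.
Proof.
move=> kn f0; rewrite (big_ord_widen n f kn) [LHS](bigID (fun i : 'I_n => i < k)%N) /=.
by rewrite [X in _ + X]big1 ?addr0 // => i; rewrite -leqNgt => /f0.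
Qed.

Lemma sum_le_trunc (R : realType) k n (f : nat -> R) : (k <= n)%N ->
  (forall i, 0 <= f i) -> \sum_(i < k) f i <= \sum_(i < n) f i.
Proof.
move=> kn f0; rewrite (big_ord_widen n f kn) [leRHS](bigID (fun i : 'I_n => i < k)%N) /=.
by rewrite lerDl sumr_ge0.
Qed.

Lemma le_sum_term (R : realType) k (f : nat -> R) i : (i < k)%N ->
  (forall i, 0 <= f i) -> f i <= \sum_(j < k) f j.
Proof. by move=> ik f0; rewrite (bigD1 (Ordinal ik)) //= lerDl sumr_ge0. Qed.

Section Recurrences.
Context (R : realType) (g : nat -> nat -> nat -> bool).
Hypothesis g12 : forall i j l, g i j l = g j i l.
Hypothesis g23 : forall i j l, g i j l = g i l j.
Hypothesis g_irr : forall i l, g i i l = false.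
Implicit Types (x y w : nat -> R).

Lemma colink_recr n i j x :
  colink n.+1 g i j x = colink n g i j x + (g i j n)%:R * x n.
Proof. by rewrite /colink big_ord_recr. Qed.

Lemma link_recr n i x :
  link n.+1 g i x x = link n g i x x + 2 * x n * colink n g i n x.
Proof.
rewrite /link big_ord_recr /= big_ord_recr /=.
have -> : g i n n = false by rewrite g12 g23 g_irr.
rewrite mul0r addr0.
under eq_bigr do rewrite big_ord_recr /=.
rewrite big_split /= /colink -addrA; congr (_ + _).
rewrite mulr_sumr -big_split /=; apply: eq_bigr => j _.
by rewrite (g23 i j n); ring.
Qed.

(** Vertex [n] occupies at most one of the three positions of a triple. *)
Lemma tri_recr n x :
  tri n.+1 g x x x = tri n g x x x + 3 * x n * link n g n x x.
Proof.
have irr a b : (g a a b = false) * (g b a a = false) * (g a b a = false).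
  by rewrite (g12 b) (g23 a b) g_irr.
have linkE i : link n.+1 g i x x = link n g i x x + 2 * x n * colink n g i n x.
  exact: link_recr.
rewrite euler // [in RHS]euler // big_ord_recr /= linkE /colink.
rewrite [X in _ + x n * (_ + _ * X)]big1 => [|i _]; last by rewrite irr mul0r.
rewrite mulr0 addr0; under eq_bigr do rewrite linkE mulrDr.
rewrite big_split /= -addrA; congr (_ + _).
have -> : \sum_(i < n) x i * (2 * x n * colink n g i n x) = 2 * x n * link n g n x x.
  rewrite /link /colink mulr_sumr; apply: eq_bigr => i _; rewrite mulrCA; congr (_ * _).
  by rewrite mulr_sumr; apply: eq_bigr => l _; rewrite (g12 i n); ring.
by ring.
Qed.

Lemma colink_trunc k n i j x : (k <= n)%N -> (forall l, (k <= l)%N -> x l = 0) ->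
  colink n g i j x = colink k g i j x.
Proof.
move=> kn x0; apply: (@sum_trunc _ k n (fun l => (g i j l)%:R * x l)) => // l /x0 ->.
by rewrite mulr0.
Qed.

Lemma link_trunc k n i x : (k <= n)%N -> (forall l, (k <= l)%N -> x l = 0) ->
  link n g i x x = link k g i x x.
Proof.
move=> kn x0.
have linkE p : link p g i x x = \sum_(j < p) x j * colink p g i j x.
  apply: eq_bigr => j _; rewrite /colink mulr_sumr; apply: eq_bigr => l _; ring.
rewrite !linkE; under eq_bigr do rewrite (colink_trunc _ _ kn) //.
apply: (@sum_trunc _ k n (fun j => x j * colink k g i j x)) => // j /x0 ->.
by rewrite mul0r.
Qed.

Lemma tri_trunc k n x : (k <= n)%N -> (forall l, (k <= l)%N -> x l = 0) ->
  tri n g x x x = tri k g x x x.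
Proof.
move=> kn x0; rewrite !euler //; under eq_bigr do rewrite (link_trunc _ kn) //.
apply: (@sum_trunc _ k n (fun j => x j * link k g j x x)) => // j /x0 ->.
by rewrite mul0r.
Qed.

Lemma colink_ge0 n i j x : (forall l, 0 <= x l) -> 0 <= colink n g i j x.
Proof. by move=> x0; rewrite /colink sumr_ge0 // => l _; rewrite mulr_ge0. Qed.

Lemma link_ge0 n i x : (forall l, 0 <= x l) -> 0 <= link n g i x x.
Proof.
move=> x0; rewrite /link sumr_ge0 // => j _; rewrite sumr_ge0 // => l _.
by rewrite !mulr_ge0.
Qed.

Lemma tri_ge0 n x : (forall l, 0 <= x l) -> 0 <= tri n g x x x.
Proof.
by move=> x0; rewrite euler // sumr_ge0 // => i _; rewrite mulr_ge0 // link_ge0.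
Qed.

Lemma tri_le_trunc k n x : (k <= n)%N -> (forall l, 0 <= x l) ->
  tri k g x x x <= tri n g x x x.
Proof.
move=> kn x0; rewrite -(subnKC kn); elim: (n - k)%N => [|p IHp]; first by rewrite addn0.
by rewrite addnS tri_recr (le_trans IHp) // lerDl !mulr_ge0 // link_ge0.
Qed.

Lemma link_ge n i p x : (forall l, (l < n)%N -> p <= x l) -> 0 <= p ->
  link n g i (fun=> 1) (fun=> 1) * p ^+ 2 <= link n g i x x.
Proof.
move=> px p0; rewrite /link mulr_suml; apply: ler_sum => j _.
rewrite mulr_suml; apply: ler_sum => l _; rewrite mulr1 mulr1 expr2.
by apply: ler_wpM2l => //; apply: ler_pM => //; exact: px.
Qed.

Lemma tri_ge n p x : (forall l, (l < n)%N -> p <= x l) -> 0 <= p ->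
  tri n g (fun=> 1) (fun=> 1) (fun=> 1) * p ^+ 3 <= tri n g x x x.
Proof.
move=> px p0; rewrite !euler // mulr_suml; apply: ler_sum => j _.
rewrite mul1r exprSr mulrA [leRHS]mulrC; apply: ler_pM => //.
- by rewrite mulr_ge0 ?exprn_ge0 // link_ge0.
- exact: link_ge.
- exact: px.
Qed.

End Recurrences.

Lemma triB (R : realType) n (g c : nat -> nat -> nat -> bool) (x : nat -> R) :
  (forall i j l, (i < n)%N -> (j < n)%N -> (l < n)%N ->
     (distinct3 i j l)%:R = (g i j l)%:R + (c i j l)%:R :> R) ->
  tri n distinct3 x x x = tri n g x x x + tri n c x x x.
Proof.
move=> gc; rewrite /tri -big_split; apply: eq_bigr => i _ /=.
rewrite -big_split; apply: eq_bigr => j _ /=; rewrite -big_split; apply: eq_bigr => l _ /=.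
by rewrite gc //; ring.
Qed.

Lemma linkB (R : realType) n (g c : nat -> nat -> nat -> bool) i (x : nat -> R) :
  (forall j l, (distinct3 i j l)%:R = (g i j l)%:R + (c i j l)%:R :> R) ->
  link n distinct3 i x x = link n g i x x + link n c i x x.
Proof.
move=> gc; rewrite /link.
rewrite -big_split; apply: eq_bigr => j _ /=; rewrite -big_split; apply: eq_bigr => l _ /=.
by rewrite gc //; ring.
Qed.

Lemma colink_distinct3 (R : realType) n i j (x : nat -> R) : (i < n)%N -> (j < n)%N -> i != j ->
  colink n distinct3 i j x = \sum_(l < n) x l - x i - x j.
Proof.
move=> i_n j_n ij; rewrite /colink (bigD1 (Ordinal i_n)) //= (bigD1 (Ordinal j_n)) /=; last first.
  by rewrite -val_eqE /= eq_sym.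
rewrite distinct3_23 distinct3_irr mul0r add0r.
rewrite distinct3E eqxx !andbF mul0r add0r.
rewrite [in RHS](bigD1 (Ordinal i_n)) //= [in RHS](bigD1 (Ordinal j_n)) /=; last first.
  by rewrite -val_eqE /= eq_sym.
rewrite [RHS](_ : _ = \sum_(l < n | (l != Ordinal i_n) && (l != Ordinal j_n)) x l); last by ring.
apply: eq_bigr => l; rewrite -!val_eqE /= => /andP[li lj].
by rewrite distinct3E ij [i == _]eq_sym li [j == _]eq_sym lj mul1r.
Qed.

(** Ordered pairs of distinct vertices other than [i]: the square of their total weight less the sum
    of their squares. The term [x i ^+ 2] compensates for the full sum of squares. *)
Lemma link_distinct3 (R : realType) n i (x : nat -> R) : (i < n)%N ->
  link n distinct3 i x x = (\sum_(l < n) x l - x i) ^+ 2 + x i ^+ 2 - \sum_(l < n) x l ^+ 2.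
Proof.
move=> i_n; set s := \sum_(l < n) x l.
have linkE : link n distinct3 i x x = \sum_(j < n) x j * colink n distinct3 i j x.
  by apply: eq_bigr => j _; rewrite /colink mulr_sumr; apply: eq_bigr => l _; ring.
rewrite linkE (bigD1 (Ordinal i_n)) //= colink_diag; last exact: distinct3_irr.
rewrite mulr0 add0r [in RHS](bigD1 (Ordinal i_n)) //=.
rewrite (eq_bigr (fun j : 'I_n => (s - x i) * x j - x j ^+ 2)) => [|j]; last first.
  by rewrite -val_eqE /= => ji; rewrite colink_distinct3 // -?/s; [ring|rewrite eq_sym].
rewrite sumrB -mulr_sumr.
have -> : \sum_(l < n | l != Ordinal i_n) x l = s - x i.
  by rewrite /s [in RHS](bigD1 (Ordinal i_n)) //=; ring.
by ring.
Qed.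

Lemma tri_distinct3_const (R : realType) n (c : R) :
  tri n distinct3 (fun=> c) (fun=> c) (fun=> c) = n%:R * (n%:R - 1) * (n%:R - 2) * c ^+ 3.
Proof.
elim: n => [|n IHn]; first by rewrite /tri big_ord0; ring.
rewrite tri_recr; [|exact: distinct3_12|exact: distinct3_23|exact: distinct3_irr].
have -> : link n distinct3 n (fun=> c) (fun=> c) = link n.+1 distinct3 n (fun=> c) (fun=> c).
  rewrite link_recr; [|exact: distinct3_12|exact: distinct3_23|exact: distinct3_irr].
  by rewrite colink_diag ?mulr0 ?addr0 //; exact: distinct3_irr.
rewrite link_distinct3 // !sumr_const !card_ord IHn -(mulr_natl c) -(mulr_natl (c ^+ 2)) -(natr1 n).
by move: (n%:R) => N; ring.
Qed.

(** * Polynomial inequalities for the case k = T + 1 *)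

(* In the next five lemmas [k = T + 1]; [a], [p], [z] are the weights of the vertices 0, T - 1, T,
   [W] and [b] the weight and size of the common link of T - 1 and T; [A], [E], [B] weigh (by
   ordered tuples) the missing triples made of T - 1 and two earlier vertices, of T and two
   vertices before T - 1, and of three vertices before T - 1, while [kT], [r2], [kr] count them. *)
Lemma top_weight_le (R : realFieldType) (a p z W A B : R) :
  0 < z -> z <= p -> p <= a -> a <= W -> 0 <= A -> 0 <= B -> a + p + z <= 1 ->
  2 * (a - p) * (1 - a - p) = A + 2 * z * (1 - W - p - z) ->
  3 * (p + z) * A + B < 6 * z ^+ 2 * W ->
  a <= p + z.
Proof.
move=> z0 zp pa aW A0 B0 apz e1 gain; pose S := 1 - a - p.
have S0 : z <= S by rewrite /S; lra.
have e1' : 2 * (a - p - z) * S = A - 2 * z * (W - a + z) by rewrite /S; lra.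
(* If a > p + z, the gain inequality and W >= a leave (a - p - z)((p + z)S - z^2) < 0, whereas z is
   at most both p + z and S. *)
rewrite leNgt; apply/negP => h.
have h1 : (p + z) * A < 2 * z ^+ 2 * W by lra.
have h2 : (p + z) * (2 * (a - p - z) * S) < 2 * z ^+ 2 * W - 2 * z * (p + z) * (W - a + z).
  by rewrite e1'; move: h1; lra.
have h3 : 0 <= 2 * z * p * (W - a).
  by apply: mulr_ge0; [apply: mulr_ge0; [apply: mulr_ge0|]|]; lra.
have h4 : z * z <= (p + z) * S by apply: ler_pM; lra.
have h5 : 0 <= ((p + z) * S - z ^+ 2) * (a - p - z) by apply: mulr_ge0; lra.
by move: h2 h3 h5; lra.
Qed.

(* Eliminating [1 - W - p - z] between the two link equations compares the values at
   [z] and [p] of the cubic [h u = u (a - u) (1 - a - u)]. *)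
Lemma link_defect_le (R : realFieldType) (a p z W A B E : R) :
  0 < z -> z <= p -> p <= a -> a <= W -> 0 <= A -> 0 <= B -> a + p + z <= 1 ->
  2 * (a - p) * (1 - a - p) = A + 2 * z * (1 - W - p - z) ->
  3 * (p + z) * A + B < 6 * z ^+ 2 * W ->
  2 * (a - z) * (1 - a - z) = E + 2 * p * (1 - W - p - z) ->
  (1 - a - p) * E <= 2 * (p - z) * (W - a + z) + 2 * (p - z) * p * (1 - a - p) + (1 - a - p) * A.
Proof.
move=> z0 zp pa aW A0 B0 apz e1 gain e2; set S := 1 - a - p.
have apz' := top_weight_le z0 zp pa aW A0 B0 apz e1 gain.
have S0 : 0 <= S by rewrite /S; lra.
have e1' : 2 * (a - p - z) * S = A - 2 * z * (W - a + z) by rewrite /S; lra.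
have a2 : 0 <= (p - z) * ((p + z) ^+ 2 - a ^+ 2).
  apply: mulr_ge0; first by lra.
  by rewrite subr_ge0 ler_pXn2r ?nnegrE //; lra.
have k1 : z * E - p * A = 2 * (p - z) * (z + p - a + a ^+ 2 - z ^+ 2 - z * p - p ^+ 2).
  have -> : E = 2 * (a - z) * (1 - a - z) - 2 * p * (1 - W - p - z) by rewrite e2; ring.
  have -> : A = 2 * (a - p) * (1 - a - p) - 2 * z * (1 - W - p - z) by rewrite e1; ring.
  by ring.
have k2 : z * E - p * A <= 2 * (p - z) * (z + p - a + z * p) by rewrite k1; move: a2; lra.
(* Multiplying by S allows the link equation [e1'] to express S(p + z - a) through W and A. *)
have k3 := ler_wpM2l S0 k2.
have k4 : S * (2 * (p - z) * (z + p - a + z * p)) =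
    (p - z) * (2 * z * (W - a + z) - A) + 2 * (p - z) * z * p * S.
  transitivity ((p - z) * (- (2 * (a - p - z) * S)) + 2 * (p - z) * z * p * S); first by ring.
  by rewrite e1'; ring.
have k5 : 0 <= A * (1 - S) * (p - z).
  by apply: mulr_ge0; [apply: mulr_ge0|]; rewrite ?/S; lra.
rewrite -(ler_pM2l z0); move: k3 k5; rewrite k4; lra.
Qed.

(** The gain inequality is multiplied by 2p/3 and divided by p + z. Here W <= ba <= b(p + z) by
    [top_weight_le], and z <= p keeps the coefficient of B at least 1/3. *)
Lemma missing_weight_lt (R : realFieldType) (a p z W A B b : R) :
  0 < z -> z <= p -> p <= a -> a <= W -> 0 <= A -> 0 <= B -> a + p + z <= 1 ->
  2 * (a - p) * (1 - a - p) = A + 2 * z * (1 - W - p - z) ->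
  3 * (p + z) * A + B < 6 * z ^+ 2 * W -> W <= b * a -> 1 <= b ->
  2 * p * A + B / 3 < 4 * p * z ^+ 2 * b.
Proof.
move=> z0 zp pa aW A0 B0 apz e1 gain Wb b1.
have apz' := top_weight_le z0 zp pa aW A0 B0 apz e1 gain.
have pz0 : 0 < p + z by lra.
have p0 : 0 < 2 / 3 * p by lra.
have Wpz : W <= b * (p + z).
  by apply: le_trans Wb _; rewrite ler_pM2l; lra.
have h1 : 0 <= B * (p - z) by apply: mulr_ge0; lra.
have h2 : 2 / 3 * p * (3 * (p + z) * A + B) < 2 / 3 * p * (6 * z ^+ 2 * W) by rewrite ltr_pM2l.
have h3 : 4 * p * z ^+ 2 * W <= 4 * p * z ^+ 2 * (b * (p + z)).
  by apply: ler_wpM2l Wpz; apply: mulr_ge0; [lra|exact: sqr_ge0].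
rewrite -(ltr_pM2l pz0); move: h1 h2 h3; lra.
Qed.

(** All vertices before T - 1 weigh at least p, so the count of missing triples bounds pE + pA + B/3
    from below; [link_defect_le] and [missing_weight_lt] bound S times it from above. Dividing by 2p
    gives the claim. *)
Lemma defect_lt (R : realFieldType) (a p z W A B E T b kT kr r2 : R) :
  0 < z -> z <= p -> p <= a -> a <= W -> 0 <= A -> 0 <= B -> a + p + z <= 1 ->
  2 * (a - p) * (1 - a - p) = A + 2 * z * (1 - W - p - z) ->
  3 * (p + z) * A + B < 6 * z ^+ 2 * W ->
  2 * (a - z) * (1 - a - z) = E + 2 * p * (1 - W - p - z) -> W <= b * a -> 1 <= b ->
  kT * p ^+ 2 <= A -> kr * p ^+ 3 <= B -> r2 * p ^+ 2 <= E ->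
  12 * T - 24 <= kr + 3 * kT + 3 * r2 + 6 * (T - 1 - b) ->
  (1 - a - p) * ((T - 3 + b) * p ^+ 2) <
    (p - z) * ((b - 1) * (p + z) + z) + (p - z) * p * (1 - a - p) + (1 - a - p) * (2 * z ^+ 2 * b).
Proof.
move=> z0 zp pa aW A0 B0 apz e1 gain e2 Wb b1 hA hB hE cnt; set S := 1 - a - p.
have apz' := top_weight_le z0 zp pa aW A0 B0 apz e1 gain.
have S0 : 0 < S by rewrite /S; lra.
have p0 : 0 < p by lra.
have pp : 0 < 2 * p by lra.
have c1 : (2 * (T - 3 + b) - kr / 3 - kT) * p ^+ 2 <= E.
  by apply: le_trans hE; rewrite ler_pM2r ?exprn_gt0 //; lra.
have c3 : 2 * (T - 3 + b) * p ^+ 3 <= p * E + p * A + B / 3.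
  have := ler_wpM2l (ltW p0) c1; have := ler_wpM2l (ltW p0) hA; move: hB; lra.
have c4 := ler_wpM2l (ltW S0) c3.
have c5 := ler_wpM2l (ltW p0) (link_defect_le z0 zp pa aW A0 B0 apz e1 gain e2); rewrite -/S in c5.
have c6 : S * (2 * p * A + B / 3) < S * (4 * p * z ^+ 2 * b).
  by rewrite ltr_pM2l //; exact: missing_weight_lt e1 gain Wb b1.
have c7 : 0 <= 2 * p * (p - z) * ((b - 1) * (p + z - a) + (b * a - W)).
  apply: mulr_ge0; first by apply: mulr_ge0; lra.
  apply: addr_ge0; last by lra.
  by apply: mulr_ge0; lra.
rewrite -(ltr_pM2l pp); move: c4 c5 c6 c7; lra.
Qed.

(** By b <= T - 3, the left side in [defect_lt] is at least 2bSp^2. The hypothesis on a + p says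
    exactly that (1 - S)(b - 1/2) <= Sb, which bounds the right side by the same quantity. *)
Lemma successor_inequalities_absurd (R : realFieldType) (a p z W A B E T b kT kr r2 : R) :
  0 < z -> z <= p -> p <= a -> a <= W -> 0 <= A -> 0 <= B -> a + p + z <= 1 ->
  2 * (a - p) * (1 - a - p) = A + 2 * z * (1 - W - p - z) ->
  3 * (p + z) * A + B < 6 * z ^+ 2 * W ->
  2 * (a - z) * (1 - a - z) = E + 2 * p * (1 - W - p - z) -> W <= b * a -> 1 <= b ->
  b <= T - 3 -> (a + p) * (4 * b - 1) <= 2 * b -> kT * p ^+ 2 <= A -> kr * p ^+ 3 <= B ->
  r2 * p ^+ 2 <= E -> 12 * T - 24 <= kr + 3 * kT + 3 * r2 + 6 * (T - 1 - b) ->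
  False.
Proof.
move=> z0 zp pa aW A0 B0 apz e1 gain e2 Wb b1 bT hS hA hB hE cnt; pose S := 1 - a - p.
have c9 := defect_lt z0 zp pa aW A0 B0 apz e1 gain e2 Wb b1 hA hB hE cnt; rewrite -/S in c9.
have c10 : 0 <= S * ((T - 3 - b) * p ^+ 2).
  apply: mulr_ge0; first by rewrite /S; lra.
  by apply: mulr_ge0; [lra|exact: sqr_ge0].
have c11 : (1 - S) * ((b - 1) * (p + z) + z) * (p - z) <= S * b * (p + z) * (p - z).
  apply: ler_wpM2r; first by lra.
  have d1 : (b - 1) * (p + z) + z <= (b - 1 / 2) * (p + z) by lra.
  have d2 : (1 - S) * (b - 1 / 2) <= S * b by rewrite /S; lra.
  apply: (@le_trans _ _ ((1 - S) * ((b - 1 / 2) * (p + z)))).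
    by apply: ler_wpM2l d1; rewrite /S; lra.
  by rewrite mulrA; apply: ler_wpM2r d2; lra.
move: c9 c10 c11; lra.
Qed.

(** * Cliques and first consequences of extremality *)

Definition clique n T : {set {set 'I_n}} :=
  [set e in triples n | [forall v in e, (v < T)%N]]%SET.

Lemma clique_sub n T : clique n T \subset triples n.
Proof. by apply/fintype.subsetP => e; rewrite inE => /andP[]. Qed.

Lemma adj_clique n T i j l : (T <= n)%N ->
  adj (clique n T) i j l = [&& distinct3 i j l, (i < T)%N, (j < T)%N & (l < T)%N].
Proof.
move=> Tn; apply/idP/and4P => [ijl|[un iT jT lT]].
  have [i_n j_n l_n un] := adjP (clique_sub n T) ijl.
  move: ijl; rewrite /adj !inE => /andP[_ /forall_inP eT]; split=> //.
  - by apply: (eT (Ordinal i_n)); rewrite !inE eqxx.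
  - by apply: (eT (Ordinal j_n)); rewrite !inE eqxx ?orbT.
  - by apply: (eT (Ordinal l_n)); rewrite !inE eqxx ?orbT.
have [[i_n j_n] l_n] := (leq_trans iT Tn, leq_trans jT Tn, leq_trans lT Tn).
rewrite /adj !inE -sum1_card (@big_triple _ 0%N addn n (fun=> 1%N)) //=.
apply/forall_inP => v; rewrite !inE => /or3P[] /eqP -> //.
Qed.

Lemma card_clique n T : (T <= n)%N -> #|clique n T| = 'C(T, 3).
Proof.
move=> Tn; rewrite -[in RHS](card_ord T).
have winj : injective (widen_ord Tn) by move=> i j /(congr1 val) /= ij; apply: val_inj.
rewrite -(card_imset _ winj) -cards_draws; apply: eq_card => e; rewrite !inE andbC; congr (_ && _).
apply/forall_inP/fintype.subsetP => [eT v /eT vT|eT v /eT /imsetP[w _ ->]]; last exact: (ltn_ord w).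
by apply/imsetP; exists (Ordinal vT) => //; apply: val_inj.
Qed.

Section Extremal.
Context (R : realType) (n m : nat) (G : {set {set 'I_n}}) (k : nat) (x : nat -> R).
Hypothesis H : extremal m G k x.
Let g := adj G.

Let g12 i j l : g i j l = g j i l. Proof. exact: adj12. Qed.
Let g23 i j l : g i j l = g i l j. Proof. exact: adj23. Qed.

Lemma ex_distinct3 i j l : g i j l -> distinct3 i j l.
Proof. by case/(adjP (ex_sub H)). Qed.
Lemma ex_irr i l : g i i l = false.
Proof. by apply/negP => /ex_distinct3; rewrite distinct3_irr. Qed.

Lemma ex_ge0 i : 0 <= x i.
Proof.
by have [/(ex_pos H)/ltW//|/(ex_zero H) ->] := ltnP i k.
Qed.

Lemma ex_lt i : (i < k)%N -> (i < n)%N.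
Proof. by move=> ik; exact: leq_trans ik (ex_dim H). Qed.

Lemma ex_move_ge0 i j s : i != j -> 0 <= s <= x j -> forall v, 0 <= move_weight i j s x v.
Proof.
move=> ij /andP[s0 sx] v; rewrite /move_weight.
have x0 := ex_ge0 v; have [vi|_] := eqVneq v i; have [vj|_] := eqVneq v j => /=.
- by move: ij; rewrite -vi -vj eqxx.
- lra.
- by rewrite vj; lra.
- lra.
Qed.

Lemma ex_move_sum i j s : (i < n)%N -> (j < n)%N -> \sum_(v < n) move_weight i j s x v = 1.
Proof.
move=> i_n j_n; have := sum_move_weight s x (fun=> 1) i_n j_n.
under eq_bigr do rewrite mulr1; move=> ->.
by under eq_bigr do rewrite mulr1; rewrite (ex_sum H); ring.
Qed.

(** The new weighting vanishes at [j], so minimality of the support makes the loss strict. *)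
Lemma move_lt i j : (i < k)%N -> (j < k)%N -> i != j ->
  tri n g (move_weight i j (x j) x) (move_weight i j (x j) x) (move_weight i j (x j) x) < tri n g x x x.
Proof.
move=> ik jk ij; rewrite !tri_lagr ?(ex_sub H) // ltr_pM2l //.
apply: (@ex_min _ _ _ _ _ _ H _ _ j) => //; [exact: ex_sub H|exact: ex_card H| | | |].
- by apply: ex_move_ge0; rewrite // ex_ge0 lexx.
- by rewrite ex_move_sum // ex_lt.
- by rewrite /move_weight eqxx eq_sym (negbTE ij) /=; ring.
move=> v kv; rewrite /move_weight (ex_zero H) // !gtn_eqF ?mulr0 ?subr0 ?addr0 //; exact: leq_trans kv.
Qed.

(** First-order optimality: otherwise moving a little weight from [j] to [i] would raise the
    Lagrangian. *)
Lemma link_le i j : (i < k)%N -> (j < k)%N -> i != j -> link n g i x x <= link n g j x x.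
Proof.
move=> ik jk ij; rewrite leNgt; apply/negP => lij.
set w := colink n g i j x; set D := link n g i x x - link n g j x x.
have D0 : 0 < D by rewrite subr_gt0.
have w0 : 0 <= w by apply: colink_ge0; exact: ex_ge0.
have w1 : 0 < 2 * w + 1 by lra.
(* Small enough for [x j] to stay nonnegative and for the linear gain to beat the quadratic loss;
   the summand 1 keeps the denominator positive when [w = 0]. *)
pose s := Num.min (x j) (D / (2 * w + 1)).
have s0 : 0 < s by rewrite /s lt_min (ex_pos H) //= divr_gt0.
have sx : s <= x j by rewrite ge_min lexx.
have sD : s * (2 * w + 1) <= D by rewrite -ler_pdivlMr // ge_min lexx orbT.
have : tri n g (move_weight i j s x) (move_weight i j s x) (move_weight i j s x) <= tri n g x x x.
  rewrite !tri_lagr ?(ex_sub H) // ler_pM2l //.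
  apply: (ex_max H); [exact: ex_sub H|exact: ex_card H| |].
    by apply: ex_move_ge0 => //; rewrite (ltW s0).
  by rewrite ex_move_sum // ex_lt.
rewrite tri_move ?ex_lt //; last exact: ex_irr.
rewrite -/w -/D => h.
have h2 : 0 < 3 * s * (D - 2 * (s * w)) by rewrite mulr_gt0 //; lra.
lra.
Qed.

Lemma link_eq i j : (i < k)%N -> (j < k)%N -> link n g i x x = link n g j x x.
Proof.
move=> ik jk; have [->//|ij] := eqVneq i j.
by apply/eqP; rewrite eq_le !link_le // eq_sym.
Qed.

(** By [euler] the form is the average of the links under the weights, and on the support these are
    all equal. *)
Lemma link_tri i : (i < k)%N -> link n g i x x = tri n g x x x.
Proof.
move=> ik; rewrite euler //.
rewrite (eq_bigr (fun j : 'I_n => x j * link n g i x x)) => [|j _].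
  by rewrite -mulr_suml (ex_sum H) mul1r.
by have [jk|/(ex_zero H) ->] := ltnP j k; [rewrite (link_eq ik jk)|rewrite !mul0r].
Qed.

(** Since the links agree, the strict loss in [move_lt] is exactly 6 x_j^2 times the weight of the
    common link. *)
Lemma cover i j : (i < k)%N -> (j < k)%N -> i != j -> 0 < colink n g i j x.
Proof.
move=> ik jk ij; have := move_lt ik jk ij.
rewrite tri_move ?ex_lt //; last exact: ex_irr.
rewrite (link_eq ik jk) subrr mulr0 addr0 gtrDl oppr_lt0 pmulr_rgt0 //.
by rewrite mulr_gt0 // exprn_gt0 // (ex_pos H).
Qed.

Lemma adj_shift i j l l' : g i j l -> (l' <= l)%N -> distinct3 i j l' -> g i j l'.
Proof.
rewrite leq_eqVlt => ijl /orP[/eqP -> //|l'l]; rewrite distinct3E => /and3P[_ il jl].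
by apply: (ex_shift H ijl) => //; rewrite eq_sym.
Qed.

(** The vertices are lowered one at a time, the smallest first, so that they stay distinct
    throughout. *)
Lemma adj_le i j l i' j' l' : g i j l -> (i < j < l)%N -> (i' < j' < l')%N ->
  (i' <= i)%N -> (j' <= j)%N -> (l' <= l)%N -> g i' j' l'.
Proof.
move=> ijl /andP[ij jl] /andP[ij' jl'] ii jj ll.
have : g i' j l.
  by rewrite g12 g23; apply: adj_shift ii _; [rewrite g23 g12|rewrite distinct3E; lia].
move=> h1; have : g i' j' l.
  by rewrite g23; apply: adj_shift jj _; [rewrite g23|rewrite distinct3E; lia].
by move=> h2; apply: adj_shift h2 ll _; rewrite distinct3E; lia.
Qed.

Lemma adj_top : (2 < k)%N -> g 0%N k.-2 k.-1.
Proof.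
move=> k2; have /cover : (k.-2 < k)%N by lia.
move=> /(_ k.-1); have -> : (k.-1 < k)%N by lia.
have -> : k.-2 != k.-1 by lia.
move=> /(_ isT isT) w0.
have [l /andP[lk gl]] : exists l, (l < k)%N && g k.-2 k.-1 l.
  apply/asboolP; apply: contraLR w0 => /asboolPn nex; rewrite -leNgt.
  rewrite (colink_trunc _ _ _ (ex_dim H)); last exact: ex_zero H.
  rewrite /colink big1 // => l _; case: (boolP (g _ _ _)) => [gl|]; last by rewrite mul0r.
  by case: nex; exists l; rewrite ltn_ord.
by rewrite g12 g23; apply: adj_shift gl (leq0n l) _; rewrite distinct3E; lia.
Qed.

Lemma adj0 i j : (0 < i)%N -> (i < j < k)%N -> g 0%N i j.
Proof.
move=> i0 /andP[ij jk]; apply: (adj_le (adj_top _)); lia.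
Qed.

(** K_T has few enough edges to compete, and the weighting vanishes at vertex T < k, so [ex_min]
    gives strictness. *)
Lemma tri_clique_lt T (y : nat -> R) : (T < k)%N -> ('C(T, 3) <= m)%N -> (forall i, 0 <= y i) ->
  \sum_(i < T) y i = 1 -> (forall i, (T <= i)%N -> y i = 0) ->
  tri T distinct3 y y y < tri n g x x x.
Proof.
move=> Tk Tm y0 y1 yT; have Tn : (T <= n)%N by apply: ltnW; exact: ex_lt.
have <- : tri n (adj (clique n T)) y y y = tri T distinct3 y y y.
  have c12 i j l : adj (clique n T) i j l = adj (clique n T) j i l by exact: adj12.
  have c23 i j l : adj (clique n T) i j l = adj (clique n T) i l j by exact: adj23.
  have cirr i l : adj (clique n T) i i l = false by rewrite adj_clique // distinct3_irr.
  rewrite (tri_trunc _ Tn) //; apply: eq_bigr => i _; apply: eq_bigr => j _.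
  by apply: eq_bigr => l _; rewrite adj_clique // !ltn_ord !andbT.
rewrite !tri_lagr ?(ex_sub H) ?clique_sub // ltr_pM2l //.
apply: (@ex_min _ _ _ _ _ _ H _ _ T); rewrite ?clique_sub ?card_clique //.
- by rewrite (sum_trunc Tn).
- exact: yT.
- by move=> i ki; apply: yT; exact: leq_trans (ltnW Tk) ki.
Qed.

(** Uniform weights 1/T give K_T the value (T - 1)(T - 2)/T^2. *)
Lemma tri_gt T : (0 < T)%N -> (T < k)%N -> ('C(T, 3) <= m)%N ->
  (T%:R - 1) * (T%:R - 2) < T%:R ^+ 2 * tri n g x x x.
Proof.
move=> T0 Tk Tm; pose y (i : nat) : R := if (i < T)%N then T%:R^-1 else 0.
have T0R : (0 : R) < T%:R by rewrite ltr0n.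
have yT i : (i < T)%N -> y i = T%:R^-1 by rewrite /y => ->.
have := @tri_clique_lt T y Tk Tm.
have -> : tri T distinct3 y y y = tri T distinct3 (fun=> T%:R^-1) (fun=> T%:R^-1) (fun=> T%:R^-1).
  by apply: eq_bigr => i _; apply: eq_bigr => j _; apply: eq_bigr => l _; rewrite !yT.
rewrite tri_distinct3_const => h.
have {}h : T%:R * (T%:R - 1) * (T%:R - 2) * T%:R^-1 ^+ 3 < tri n g x x x.
  apply: h.
  - by move=> i; rewrite /y; case: ifP => // _; rewrite invr_ge0 ler0n.
  - under eq_bigr do rewrite yT //.
    by rewrite sumr_const card_ord -(mulr_natl (T%:R^-1)) divff // gt_eqF.
  - by move=> i Ti; rewrite /y ltnNge Ti.
have := h; rewrite -(ltr_pM2l (_ : 0 < T%:R ^+ 2)) ?exprn_gt0 //.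
congr (_ < _); field; exact: lt0r_neq0.
Qed.

(** By [adj0] the link of vertex 0 is complete on the support. *)
Lemma link0 : (2 < k)%N -> link n g 0 x x = (1 - x 0%N) ^+ 2 + x 0%N ^+ 2 - \sum_(j < n) x j ^+ 2.
Proof.
move=> k2; rewrite -(ex_sum H) -link_distinct3; last by apply: ex_lt; lia.
have kn := ex_dim H; have x0 := ex_zero H.
rewrite !(link_trunc _ _ kn) //.
apply: eq_bigr => j _; apply: eq_bigr => l _; congr ((nat_of_bool _)%:R * _).
case: (boolP (distinct3 _ _ _)) => [|]; last by apply: contraNF => /ex_distinct3.
rewrite distinct3E => /and3P[h1 h2 h3].
have [jl|lj|/val_inj jl] := ltngtP j l.
- by rewrite adj0 //; have := ltn_ord l; lia.
- by rewrite g23 adj0 //; have := ltn_ord j; lia.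
- by move: h3; rewrite jl eqxx.
Qed.

End Extremal.

(** * Missing triples and their links *)

(** [distinct3] excludes degenerate index triples, which [~~ g] alone would count as missing. *)
Definition co (g : nat -> nat -> nat -> bool) i j l := distinct3 i j l && ~~ g i j l.

Section Complement.
Context (R : realType) (n m : nat) (G : {set {set 'I_n}}) (k : nat) (x : nat -> R).
Hypothesis H : extremal m G k x.
Let g := adj G.
Let c := co g.

Lemma co12 i j l : c i j l = c j i l.
Proof. by rewrite /c /co distinct3_12 /g adj12. Qed.

Lemma co23 i j l : c i j l = c i l j.
Proof. by rewrite /c /co distinct3_23 /g adj23. Qed.

Lemma co_irr i l : c i i l = false.
Proof. by rewrite /c /co distinct3_irr. Qed.

Lemma distinct3_co i j l : (distinct3 i j l)%:R = (g i j l)%:R + (c i j l)%:R :> R.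
Proof.
rewrite /c /co; case: (boolP (g i j l)) => [/(ex_distinct3 H) ->|_]; first by rewrite addr0.
by rewrite andbT add0r.
Qed.

(** The links of [i] and 0 are equal in G and that of 0 is complete, so what [i] misses is the
    difference of the two complete links. *)
Lemma link_co i : (2 < k)%N -> (i < k)%N ->
  link k c i x x = 2 * (x 0%N - x i) * (1 - x 0%N - x i).
Proof.
move=> k2 ik; rewrite -(link_trunc _ _ (ex_dim H)); last exact: ex_zero H.
have := @linkB R n g c i x (distinct3_co i); rewrite link_distinct3 ?(ex_lt H) // (ex_sum H).
rewrite (link_tri H ik) -(link_tri H (_ : (0 < k)%N)) ?(link0 H k2); last by lia.
by rewrite -/g; lra.
Qed.

(** A triple of the first k vertices with an element at most q lies, when sorted, below {q, k - 2, k
    - 1} in every coordinate. *)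
Lemma adj_min q i j l : (q < k.-2)%N -> g q k.-2 k.-1 -> distinct3 i j l ->
  (i < k)%N -> (j < k)%N -> (l < k)%N -> [|| (i <= q)%N, (j <= q)%N | (l <= q)%N] ->
  g i j l.
Proof.
move=> qk gq un ik jk lk ijl; move: (un); rewrite distinct3E => /and3P[ij il jl].
have top a b d : (a < b < d)%N -> (d < k)%N -> (a <= q)%N -> g a b d.
  by move=> abd dk aq; apply: (adj_le H gq); lia.
have [h|[h|[h|[h|[h|h]]]]] : (i < j < l)%N \/ (i < l < j)%N \/ (j < i < l)%N \/
    (j < l < i)%N \/ (l < i < j)%N \/ (l < j < i)%N by lia.
- by apply: top => //; lia.
- by rewrite /g adj23; apply: top => //; lia.
- by rewrite /g adj12; apply: top => //; lia.
- by rewrite /g adj12 adj23; apply: top => //; lia.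
- by rewrite /g adj23 adj12; apply: top => //; lia.
- by rewrite /g adj12 adj23 adj12; apply: top => //; lia.
Qed.

End Complement.

(** * The case k = T + 1, with U = T - 1 *)

Section Successor.
Context (R : realType) (n m : nat) (G : {set {set 'I_n}}) (U : nat) (x : nat -> R).
Hypothesis H : extremal m G U.+2 x.
Hypothesis U2 : (1 < U)%N.
Hypothesis Um : ('C(U.+1, 3) <= m)%N.
(** Six times C(T, 3) + C(T - 2, 2) + 1, for T = U + 1. *)
Hypothesis mU : 6 * m%:R <=
  (U%:R + 1) * U%:R * (U%:R - 1) + 3 * (U%:R - 1) * (U%:R - 2) + 6 :> R.
Let g := adj G.
Let c := co g.
Let a := x 0%N.
Let p := x U.
Let z := x U.+1.
Let W := colink U g U U.+1 x.
Let A := link U c U x x.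
Let E := link U c U.+1 x x.
Let B := tri U c x x x.
Let b := colink U g U U.+1 (fun=> 1 : R).
Let kT := link U c U (fun=> 1 : R) (fun=> 1).
Let kr := tri U c (fun=> 1 : R) (fun=> 1) (fun=> 1).
Let r2 := link U c U.+1 (fun=> 1 : R) (fun=> 1).

Let c12 : forall i j l, c i j l = c j i l. Proof. exact: co12. Qed.
Let c23 : forall i j l, c i j l = c i l j. Proof. exact: co23. Qed.
Let cirr : forall i l, c i i l = false. Proof. exact: co_irr. Qed.
Let cirr3 i l : (c i i l = false) * (c l i i = false) * (c i l i = false).
Proof. by rewrite (c12 l) (c23 i l) !cirr. Qed.
Let girr3 i l : (g i i l = false) * (g l i i = false) * (g i l i = false).
Proof. by rewrite /g (adj12 G l) (adj23 G i l) !(ex_irr H). Qed.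

Lemma succ_colink (y : nat -> R) :
  colink U g U U.+1 y + colink U c U U.+1 y = \sum_(l < U) y l.
Proof.
rewrite /colink -big_split; apply: eq_bigr => l _ /=.
have un : distinct3 U U.+1 l by have := ltn_ord l; rewrite distinct3E; lia.
by rewrite -mulrDl -(distinct3_co H) un mul1r.
Qed.

Lemma succ_sum : \sum_(l < U) x l = 1 - p - z.
Proof.
have := ex_sum H; rewrite (sum_trunc (ex_dim H) (ex_zero H)) !big_ord_recr /= -/p -/z.
by move=> <-; ring.
Qed.

(** The missing triples through [U] that avoid [U.+1] give [A]; those containing it have third
    vertices of total weight 1 - p - z - W. Their sum is known from [link_co]. *)
Lemma succ_link_U : 2 * (a - p) * (1 - a - p) = A + 2 * z * (1 - W - p - z).
Proof.
transitivity (link U.+2 c U x x); first by rewrite (link_co H) //; lia.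
rewrite link_recr // link_recr // colink_diag // colink_recr cirr3.
have := succ_colink x; rewrite -/W succ_sum => /(canRL (addKr _)) ->.
by rewrite -/A -/z /=; ring.
Qed.

Lemma succ_link_U1 : 2 * (a - z) * (1 - a - z) = E + 2 * p * (1 - W - p - z).
Proof.
transitivity (link U.+2 c U.+1 x x); first by rewrite (link_co H) //; lia.
rewrite link_recr // link_recr // colink_diag // (colink_sym U c12).
have := succ_colink x; rewrite -/W succ_sum => /(canRL (addKr _)) ->.
by rewrite -/E -/p /=; ring.
Qed.

Let p_gt0 : 0 < p. Proof. by apply: (ex_pos H). Qed.
Let z_gt0 : 0 < z. Proof. by apply: (ex_pos H). Qed.

(* Moving the weight of the last vertex onto the one before it gives a weighting
   of the first [U.+1] vertices, on which the missing triples may be added. *)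
Lemma succ_gain : 3 * (p + z) * A + B < 6 * z ^+ 2 * W.
Proof.
pose y := move_weight U U.+1 z x.
have [Uk U1k] : (U < U.+2)%N /\ (U.+1 < U.+2)%N by lia.
have y0 v : 0 <= y v by apply: (ex_move_ge0 H); [lia|rewrite ltW // lexx].
have ylt v : (v < U)%N -> y v = x v.
  move=> vU; have -> : y v = x v + z * (v == U)%:R - z * (v == U.+1)%:R by [].
  have [-> ->] : (v == U) = false /\ (v == U.+1) = false by lia.
  by rewrite /=; ring.
have yU : y U = p + z by rewrite /y /move_weight eqxx ltn_eqF //= -/p; ring.
have ygt v : (U < v)%N -> y v = 0.
  move=> Uv; rewrite /y /move_weight gtn_eqF //=.
  have [->|vU] := eqVneq v U.+1 => /=; first by rewrite -/z; ring.
  by rewrite (ex_zero H); [ring|lia].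
have y1 : \sum_(i < U.+1) y i = 1.
  rewrite big_ord_recr /= yU; under eq_bigr do rewrite ylt //.
  by rewrite succ_sum; ring.
have := tri_clique_lt H U1k Um y0 y1 ygt.
have := tri_move (adj12 G) (adj23 G) (ex_irr H) z x (ex_lt H Uk) (ex_lt H U1k).
rewrite (link_eq H Uk U1k) subrr mulr0 addr0 -/y.
have -> : colink n (adj G) U U.+1 x = W.
  rewrite (colink_trunc _ _ _ (ex_dim H) (ex_zero H)) !colink_recr -/g !girr3.
  by rewrite !mul0r !addr0.
rewrite (@tri_trunc _ _ U.+1 n y) //; last exact: ex_lt H _ Uk.
rewrite (@triB _ U.+1 g c y) => [|i j l _ _ _]; last exact: (distinct3_co H).
have -> : tri U.+1 c y y y = B + 3 * (p + z) * A.
  rewrite tri_recr // yU /B /A; congr (_ + _ * _).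
    by apply: eq_bigr => i _; apply: eq_bigr => j _; apply: eq_bigr => l _; rewrite !ylt.
  by apply: eq_bigr => j _; apply: eq_bigr => l _; rewrite !ylt.
by rewrite -/g => ->; lra.
Qed.

Let lb v : (v < U)%N -> p <= x v. Proof. by move=> vU; apply: (ex_mono H); lia. Qed.

(** On the left, the ordered triples on [U.+2] vertices less the bound on [6 * m]; on the right, the
    missing ones, sorted by which of the last two vertices they contain. *)
Lemma succ_count : 12 * (U%:R + 1) - 24 <= kr + 3 * kT + 3 * r2 + 6 * (U%:R + 1 - 1 - b).
Proof.
have one0 (i : nat) : 0 <= (fun=> 1 : R) i by [].
have h1 : tri n g (fun=> 1) (fun=> 1) (fun=> 1) <= 6 * m%:R :> R.
  by rewrite /g tri_card ?(ex_sub H) // ler_pM2l // ler_nat (ex_card H).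
have := @tri_le_trunc _ g (adj12 G) (adj23 G) (ex_irr H) _ _ _ (ex_dim H) one0.
have := @triB _ U.+2 g c (fun=> 1) (fun i j l _ _ _ => distinct3_co H i j l).
rewrite tri_distinct3_const !(tri_recr c12 c23 cirr) (link_recr c12 c23 cirr) -/kr -/kT -/r2.
rewrite (colink_sym U c12).
have := succ_colink (fun=> 1); rewrite -/b sumr_const card_ord => /(canRL (addKr _)) ->.
rewrite expr1n -!natr1; move: h1 mU; clear one0; lra.
Qed.

Lemma succ_b_le : b <= U%:R + 1 - 3.
Proof.
have Ub : (U.-2 < U)%N by lia.
have [gU|gU] := boolP (g U.-2 U U.+1); last first.
  rewrite /b /colink (_ : U%:R + 1 - 3 = U.-2%:R); last first.
    by rewrite -[in LHS](_ : U.-2.+2 = U); [rewrite -!natr1; ring|lia].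
  rewrite -[leRHS](_ : \sum_(l < U.-2) (1 : R) = _); last by rewrite sumr_const card_ord.
  have U2U : (U.-2 <= U)%N by lia.
  rewrite (big_ord_widen U (fun=> 1) U2U) [leRHS]big_mkcond; apply: ler_sum => l _.
  rewrite mulr1; case: ltnP => Ul; first by rewrite lern1 leq_b1.
  case: (boolP (g U U.+1 l)) => // gl; case/negP: gU.
  have lU := ltn_ord l.
  have gl' : g l U U.+1 by rewrite /g adj12 adj23.
  by apply: (adj_le H gl'); lia.
(* Otherwise [adj_min] makes every missing triple contain both last vertices. At most one triple is
   then missing, too few for [succ_count]. *)
have c0 i j l : (i < U.+2)%N -> (j < U)%N -> (l < U)%N -> c i j l = false.
  move=> iU jU lU; apply/negP => /andP[un /negP[]].
  apply: (adj_min H (q := U.-2)) => //; try lia.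
  by move: un; rewrite distinct3E; lia.
have kr0 : kr = 0.
  by rewrite /kr /tri big1 // => i _; rewrite big1 // => j _; rewrite big1 // => l _;
    rewrite c0 ?mul0r //; have := ltn_ord i; lia.
have kT0 : kT = 0.
  by rewrite /kT /link big1 // => j _; rewrite big1 // => l _; rewrite c0 ?mul0r.
have r20 : r2 = 0.
  by rewrite /r2 /link big1 // => j _; rewrite big1 // => l _; rewrite c0 ?mul0r.
have b_ge : U%:R - 1 <= b.
  rewrite (_ : U%:R - 1 = U.-1%:R); last first.
    by rewrite -[in LHS](_ : U.-1.+1 = U); [rewrite -!natr1; ring|lia].
  rewrite -[leLHS](_ : \sum_(l < U.-1) (1 : R) = _); last by rewrite sumr_const card_ord.
  have U2U : (U.-1 <= U)%N by lia.
  rewrite (big_ord_widen U (fun=> 1) U2U) [leLHS]big_mkcond; apply: ler_sum => l _.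
  rewrite mulr1; case: ltnP => // lU.
  rewrite (_ : g _ _ _) //; apply: (adj_min H (q := U.-2)) => //; rewrite ?distinct3E; lia.
have := succ_count; rewrite kr0 kT0 r20.
have : (2 : R) <= U%:R by rewrite ler_nat.
lra.
Qed.

Lemma succ_b_ge : 1 <= b.
Proof.
have U0 : (0 < U)%N by lia.
have := @le_sum_term R U (fun l => (g U U.+1 l)%:R * 1) 0 U0.
have -> : g U U.+1 0%N by rewrite /g adj23 adj12; apply: (adj0 H); lia.
by rewrite mulr1; apply => i; rewrite mulr1.
Qed.

Lemma succ_W_le : W <= b * a.
Proof.
rewrite /W /b /colink mulr_suml; apply: ler_sum => l _; rewrite mulr1.
by apply: ler_wpM2l => //; apply: (ex_mono H).
Qed.

Lemma succ_W_ge : a <= W.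
Proof.
have U0 : (0 < U)%N by lia.
have := @le_sum_term R U (fun l => (g U U.+1 l)%:R * x l) 0 U0.
have -> : g U U.+1 0%N by rewrite /g adj23 adj12; apply: (adj0 H); lia.
by rewrite mul1r; apply => i; rewrite mulr_ge0 // (ex_ge0 H).
Qed.

Lemma succ_tri_le : tri n g x x x <= (1 - a) ^+ 2.
Proof.
have k2 : (2 < U.+2)%N by lia.
rewrite /g -(link_tri H (ltn0Sn U.+1)) (link0 H k2) -/a.
have := @le_sum_term R n (fun l => x l ^+ 2) 0 (ex_lt H (ltn0Sn U.+1)).
by move=> /(_ (fun i => sqr_ge0 _)); rewrite -/a; lra.
Qed.

(** The clique bound against (1 - a)^2 limits a, and then a + Up <= 1 limits p. *)
Lemma succ_ap : (a + p) * (4 * b - 1) <= 2 * b.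
Proof.
have hF := succ_tri_le; have hT := tri_gt H (ltn0Sn U) (ltnSn U.+1) Um.
have b1 := succ_b_ge; have bU := succ_b_le.
have pa : p <= a by apply: (ex_mono H).
have sumU : a + U%:R * p <= 1.
  have : a + U%:R * p <= \sum_(l < U.+1) x l.
    rewrite big_ord_recl /= lerD2l mulr_natl -[in leLHS](card_ord U) -sumr_const.
    apply: ler_sum => i _; apply: (ex_mono H); rewrite /= /bump /=; exact: ltn_ord.
  by rewrite big_ord_recr /= succ_sum -/p; have := z_gt0; lra.
have a0 : 0 < a by apply: (ex_pos H).
have a1 : a <= 1.
  have : 0 <= U%:R * p by rewrite mulr_ge0 // ltW.
  by move: sumU; lra.
move: hT; rewrite -/g -natr1 => hT.
have {hF}hT : U%:R * (U%:R - 1) < (U%:R + 1) ^+ 2 * (1 - a) ^+ 2.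
  have : (U%:R + 1) ^+ 2 * tri n g x x x <= (U%:R + 1) ^+ 2 * (1 - a) ^+ 2.
    by rewrite ler_wpM2l // sqr_ge0.
  by move: hT; lra.
(* The bounds 1 <= b <= U - 2 exclude U = 2. For U = 3 they force b = 1, and a + p <= 2/3 suffices;
   for U >= 4 even a + p <= 1/2 holds. *)
have [U3|U4] : U = 3%N \/ (4 <= U)%N.
- have : (2 < U)%N by rewrite -(ler_nat R); lra.
  by rewrite leq_eqVlt => /orP[/eqP <-|]; [left|right].
- rewrite U3 in bU sumU hT.
  have a2 : a <= 2 / 5.
    rewrite leNgt; apply/negP => ha.
    have : 0 <= (a - 2 / 5) * (8 / 5 - a) by rewrite mulr_ge0 //; lra.
    by lra.
  by rewrite (_ : b = 1); lra.
have u4 : (4 : R) <= U%:R by rewrite ler_nat.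
have a3 : a <= 1 / 3.
  rewrite leNgt; apply/negP => ha.
  have h1 : (1 - a) ^+ 2 <= 4 / 9.
    have : 0 <= (a - 1 / 3) * (5 / 3 - a).
      by rewrite mulr_ge0 //; lra.
    by lra.
  have h2 : (U%:R + 1) ^+ 2 * (1 - a) ^+ 2 <= (U%:R + 1) ^+ 2 * (4 / 9).
    by rewrite ler_wpM2l // sqr_ge0.
  have h3 : 0 <= (U%:R - 4) * (5 * U%:R + 3) :> R by rewrite mulr_ge0 //; lra.
  by lra.
have p4 : 4 * p <= 1 - a.
  have : 4 * p <= U%:R * p by rewrite ler_wpM2r // ltW.
  by lra.
have : (a + p) * (4 * b - 1) <= 1 / 2 * (4 * b - 1) by rewrite ler_wpM2r //; lra.
by lra.
Qed.

Lemma succ_absurd : False.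
Proof.
have le_x i : (i < U)%N -> p <= x i by exact: lb.
have A0 : 0 <= A by apply: link_ge0; exact: (ex_ge0 H).
have B0 : 0 <= B by apply: tri_ge0; exact: (ex_ge0 H).
apply: (@successor_inequalities_absurd R a p z W A B E (U%:R + 1) b kT kr r2) => //.
- by apply: (ex_mono H).
- by apply: (ex_mono H).
- exact: succ_W_ge.
- have : a <= \sum_(l < U) x l by apply: le_sum_term; [lia|exact: (ex_ge0 H)].
  by rewrite succ_sum; lra.
- exact: succ_link_U.
- exact: succ_gain.
- exact: succ_link_U1.
- exact: succ_W_le.
- exact: succ_b_ge.
- exact: succ_b_le.
- exact: succ_ap.
- by apply: link_ge => //; exact: ltW.
- by apply: tri_ge => //; exact: ltW.
- by apply: link_ge => //; exact: ltW.
- exact: succ_count.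
Qed.

End Successor.

(** * The case k >= T + 2 *)

(* [s = T - 1], [a] and [t] are the weights of vertex 0 and of the vertices from [T - 2] on,
   and [F] is 6 times the Lagrangian. *)
Lemma far_alg (R : realFieldType) (s a t F : R) :
  s = 3 \/ 4 <= s -> 0 <= a <= 1 -> 1 <= (s - 1) * a + t -> t < a ->
  s ^+ 2 * F <= s ^+ 2 * (1 - a) ^+ 2 - 2 * s * (1 - a - t) + (s - 2) ->
  F <= (1 - a) ^+ 2 -> s * (s - 1) < (s + 1) ^+ 2 * F -> False.
Proof.
move=> hs /andP[a0 a1] h1 ta hF Fa Fs.
have s3 : 3 <= s by case: hs; lra.
(* The quotient s(s - 1)/(s + 1)^2 is at least its value 3/8 at s = 3, and (3/5)^2 < 3/8. *)
have a2 : a <= 2 / 5.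
  rewrite leNgt; apply/negP => ha.
  have h2 : 0 <= (a - 2 / 5) * (8 / 5 - a) by rewrite mulr_ge0 //; lra.
  have h3 : (s + 1) ^+ 2 * F <= (s + 1) ^+ 2 * (3 / 8).
    by rewrite ler_wpM2l ?sqr_ge0 //; lra.
  have h4 : 0 <= (5 * s + 1) * (s - 3) by rewrite mulr_ge0 //; lra.
  by lra.
have a_gt : 0 < s * a - 1 by lra.
have st : s * t <= s * a by rewrite ler_wpM2l ?ltW //; lra.
(* The last product has the factor sa - 1 > 0. For s >= 4 it is nonpositive by a <= 2/5; for s = 3
   it is (3a - 1)^2, at most 1/25. *)
have hF2 : s ^+ 2 * F <= s ^+ 2 - 3 * s + 3 + (s * a - 1) * (s * a + 5 - 2 * s) by lra.
case: hs => [s_eq|s4]; first by rewrite s_eq in hF2 Fs a_gt *; nra.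
have h5 : 0 <= (s * a - 1) * (2 * s - 5 - s * a).
  have : s * a <= s * (2 / 5) by rewrite ler_wpM2l //; lra.
  by move=> h; rewrite mulr_ge0 //; lra.
have h6 : (s + 1) ^+ 2 * (s ^+ 2 * F) <= (s + 1) ^+ 2 * (s ^+ 2 - 3 * s + 3).
  by rewrite ler_wpM2l ?sqr_ge0 //; lra.
have h7 : s ^+ 2 * (s * (s - 1)) < s ^+ 2 * ((s + 1) ^+ 2 * F).
  by rewrite ltr_pM2l // exprn_gt0 //; lra.
have h8 : 0 <= (s - 3) * (2 * s + 3) by rewrite mulr_ge0 //; lra.
lra.
Qed.

Lemma exists_card_subset (T : finType) (A : {set T}) p :
  (p <= #|A|)%N -> exists2 B : {set T}, B \subset A & #|B| = p.
Proof.
move=> pA; exists [set:: take p (enum A)]%SET.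
  by apply/fintype.subsetP => v; rewrite inE => /mem_take; rewrite mem_enum.
rewrite cardsE; have /card_uniqP -> : uniq (take p (enum A)) by rewrite take_uniq ?enum_uniq.
by rewrite size_takel // -cardE.
Qed.

Lemma tripleP n (e : {set 'I_n}) : #|e| = 3%N ->
  exists i j l : nat, [/\ (i < j < l)%N, (l < n)%N & e = triple n i j l].
Proof.
move=> e3; have /card_gt0P[i ie] : (0 < #|e|)%N by rewrite e3.
have /card_gt0P[j je] : (0 < #|(e :\ i)%SET|)%N by have := cardsD1 i e; rewrite ie e3; lia.
have /card_gt0P[l le] : (0 < #|(e :\ i :\ j)%SET|)%N.
  by have := cardsD1 i e; have := cardsD1 j (e :\ i)%SET; rewrite ie je e3; lia.
have /eqP eE : e == triple n i j l by rewrite eq_triple // ie je.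
have [i_n j_n l_n] : [/\ (i < n)%N, (j < n)%N & (l < n)%N] by [].
have : distinct3 i j l by move: e3; rewrite eE => /card_triple[].
move: (i : nat) (j : nat) (l : nat) i_n j_n l_n eE => {ie je le} {}i {}j {}l i_n j_n l_n eE.
rewrite distinct3E => /and3P[ij il jl].
have [h|[h|[h|[h|[h|h]]]]] : (i < j < l)%N \/ (i < l < j)%N \/ (j < i < l)%N \/
    (j < l < i)%N \/ (l < i < j)%N \/ (l < j < i)%N by lia.
- by exists i, j, l.
- by exists i, l, j; rewrite -triple_perm23.
- by exists j, i, l; rewrite -triple_perm12.
- by exists j, l, i; rewrite -triple_perm23 -triple_perm12.
- by exists l, i, j; rewrite -triple_perm12 -triple_perm23.
- by exists l, j, i; rewrite -triple_perm23 -triple_perm12 -triple_perm23.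
Qed.

Lemma triple_inj n i j i' j' l : (i < j < l)%N -> (i' < j' < l)%N -> (l < n)%N ->
  triple n i j l = triple n i' j' l -> i = i' /\ j = j'.
Proof.
move=> ijl ijl' ln /setP eE.
have memE v : (v < n)%N -> (v \in [:: i; j; l]) = (v \in [:: i'; j'; l]).
  by move=> vn; have := eE (Ordinal vn); rewrite !inE.
have := memE i; have := memE j; have := memE i'; have := memE j'.
rewrite !inE !eqxx ?orbT /=.
by lia.
Qed.

Section Far.
Context (R : realType) (n m : nat) (G : {set {set 'I_n}}) (k : nat) (x : nat -> R) (T : nat).
Hypothesis H : extremal m G k x.
Hypothesis T2 : (2 < T)%N.
Hypothesis Tk : (T.+1 < k)%N.
Hypothesis Tm : ('C(T, 3) <= m)%N.
Hypothesis mT : (m + 2 * T <= 'C(T.+1, 3) + 4)%N.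
Let g := adj G.
Let q := k.-1.
Let r := k.-2.

Let q_k : (q < k)%N. Proof. by rewrite /q; lia. Qed.
Let r_k : (r < k)%N. Proof. by rewrite /r; lia. Qed.
Let r_q : (r < q)%N. Proof. by rewrite /r /q; lia. Qed.
Let q_n : (q < n)%N := ex_lt H q_k.
Let D := [set e in G | Ordinal q_n \in e]%SET.
Let Miss := (clique n T.+1 :\: G)%SET.

Let Tn : (T.+1 <= n)%N. Proof. by apply: ltnW; exact: ex_lt H _ Tk. Qed.

Lemma far_tripleD i j : g i j q -> triple n i j q \in D.
Proof.
move=> gij; rewrite inE; apply/andP; split; first exact: gij.
by rewrite !inE /= eqxx !orbT.
Qed.

(** The last vertex lies outside the first [T.+1], so the edges in [D] are disjoint from those
    inside the clique. *)
Lemma far_miss : (#|D| + 2 * T <= #|Miss| + 4)%N.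
Proof.
have := cardsID G (clique n T.+1); rewrite card_clique // -/Miss.
have : (#|clique n T.+1 :&: G| + #|D| <= #|G|)%N.
  rewrite -cardsUI [X in (_ + X)%N](_ : _ = 0%N) ?addn0; last first.
    apply: eq_card0 => e; rewrite !inE; apply/negP => /andP[/andP[/andP[_ /forall_inP eT] _] /andP[_ qe]].
    by have := eT _ qe; rewrite /= /q; lia.
  by apply: subset_leq_card; apply/fintype.subsetP => e; rewrite !inE => /orP[/andP[]|/andP[]].
have := ex_card H; move: mT; lia.
Qed.

Lemma far_top : g 0%N r q.
Proof. by apply: (adj_top H); lia. Qed.

(** Otherwise only {T - 2, T - 1, T} could be missing from the first T + 1 vertices, against
    [far_miss]. *)
Lemma far_not_adj : ~~ g (T - 3)%N r q.
Proof.
apply/negP => gT.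
have M1 : (#|Miss| <= 1)%N.
  rewrite -(cards1 (triple n (T - 2) (T - 1) T)); apply: subset_leq_card.
  apply/fintype.subsetP => e; rewrite !inE => /andP[eG /andP[/eqP e3 /forall_inP eT]].
  have [i [j [l [ijl ln eE]]]] := tripleP e3.
  have lT : (l < T.+1)%N by apply: (eT (Ordinal ln)); rewrite eE !inE eqxx !orbT.
  rewrite eE; have iT : (T - 3 < i)%N.
    rewrite ltnNge; apply: contraNN eG => iT; rewrite eE.
    by apply: (adj_min H _ gT); rewrite ?distinct3E; lia.
  have [-> [-> ->]] : i = (T - 2)%N /\ j = (T - 1)%N /\ l = T by lia.
  exact: eqxx.
have : (0 < #|D|)%N by apply/card_gt0P; exists (triple n 0 r q); apply: far_tripleD; exact: far_top.
by have := far_miss; lia.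
Qed.

(** By compression the common link of the last two vertices is an initial segment; [b] is its first
    gap. *)
Lemma far_codegree : exists2 b, (0 < b <= T - 3)%N & forall i, (i < r)%N -> g i r q = (i < b)%N.
Proof.
have exb : exists i, ~~ g i r q by exists (T - 3)%N; exact: far_not_adj.
case: (ex_minnP exb) => b gb bmin; exists b.
  rewrite bmin ?far_not_adj // andbT lt0n; apply: contraNneq gb => ->; exact: far_top.
move=> i ir; apply/idP/idP => [gi|ib]; last by rewrite -[g _ _ _]negbK; apply/negP => /bmin; lia.
rewrite ltnNge; apply: contraNN gb => bi.
by apply: (adj_le H gi) => //; lia.
Qed.

(** For each i < b, compressing {i, r, q} yields the edges {i, j, q} with i < j <= i + (k - T + 2);
    such j are at most r because b <= T - 3. *)
Lemma far_card b : (b <= T - 3)%N -> (forall i, (i < r)%N -> g i r q = (i < b)%N) ->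
  (b * (k - T + 2) <= #|D|)%N.
Proof.
move=> bT gb.
pose f (ic : 'I_b * 'I_(k - T + 2)) := triple n ic.1 (ic.1 + ic.2).+1 q.
have lt_f (ic : 'I_b * 'I_(k - T + 2)) : (ic.1 < (ic.1 + ic.2).+1 < q)%N.
  by case: ic => i c /=; have := ltn_ord i; have := ltn_ord c; rewrite /q; lia.
have f_inj : injective f.
  move=> [i c] [i' c'] /(triple_inj (lt_f (i, c)) (lt_f (i', c')) q_n) /= [ii cc].
  by congr pair; apply: val_inj => //=; lia.
rewrite -[b in X in (X <= _)%N]card_ord -[(k - T + 2)%N in X in (X <= _)%N]card_ord -card_prod.
rewrite -(card_imset _ f_inj); apply: subset_leq_card.
apply/fintype.subsetP => _ /imsetP[ic _ ->]; apply: far_tripleD.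
have i_b := ltn_ord ic.1; have := lt_f ic => lt_ic.
have gi : g ic.1 r q by rewrite gb //; move: (lt_ic); rewrite /r /q; lia.
by apply: (adj_le H gi) => //; move: (lt_ic) i_b; rewrite /r /q; lia.
Qed.

Lemma far_colink b : (b <= T - 3)%N -> (forall i, (i < r)%N -> g i r q = (i < b)%N) ->
  colink n g r q x <= b%:R * x 0%N.
Proof.
move=> bT gb; have bn : (b <= n)%N by lia.
have -> : b%:R * x 0%N = \sum_(l < b) x 0%N by rewrite sumr_const card_ord mulr_natl.
rewrite (big_ord_widen n (fun=> x 0%N) bn) big_mkcond; apply: ler_sum => l _ /=.
have xl0 := ex_ge0 H l.
case: ltnP => lb.
  by apply: le_trans (ex_mono H (leq0n l)); rewrite ler_piMl // lern1 leq_b1.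
have [lk|/(ex_zero H) ->] := ltnP l k; last by rewrite mulr0.
case: (boolP (g r q l)) => [gl|]; last by rewrite mul0r.
have := ex_distinct3 H gl; rewrite distinct3E => un.
have lr : (l < r)%N by move: un lk; rewrite /r /q; lia.
by have := gb l lr; rewrite /g adj12 adj23 -/g gl ltnNge lb.
Qed.

(* The edges through the last vertex become worthless once its weight is moved onto
   vertex [r], so they may be traded for triples missing from the first [T.+1] vertices. *)
Lemma far_swap : #|D|%:R * x (T - 2)%N < colink n g r q x.
Proof.
have z0 : 0 < x q by apply: (ex_pos H).
have rq : r != q by rewrite /r /q; lia.
pose y := move_weight r q (x q) x.
have yq : y q = 0 by rewrite /y /move_weight eqxx gtn_eqF //=; ring.
have y0 v : 0 <= y v by apply: (ex_move_ge0 H rq); rewrite ltW // lexx.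
have yx v : (v < q)%N -> x v <= y v.
  move=> vq; rewrite /y /move_weight (ltn_eqF vq) /= mulr0n mulr0 subr0 lerDl.
  by rewrite mulr_ge0 // ltW.
have Dmiss : (#|D| <= #|Miss|)%N by have := far_miss; lia.
have [A AM Ad] := exists_card_subset Dmiss.
have DG : D \subset G by apply/fintype.subsetP => e; rewrite inE => /andP[].
have AG : [disjoint (G :\: D)%SET & A].
  apply/pred0P => e /=; apply/negP => /andP[/setDP[eG _] /(fintype.subsetP AM)].
  by rewrite inE eG.
pose G' := ((G :\: D) :|: A)%SET.
have G'T : G' \subset triples n.
  rewrite finset.subUset (fintype.subset_trans (finset.subsetDl _ _) (ex_sub H)) /=.
  apply: fintype.subset_trans AM _; apply: fintype.subset_trans (finset.subsetDl _ _) _; exact: clique_sub.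
have G'm : (#|G'| <= m)%N.
  rewrite (leq_trans (leq_card_setU _ _)) // Ad (leq_trans _ (ex_card H)) //.
  by have := cardsID D G; rewrite (finset.setIidPr DG); lia.
have lpG' : lagr G' y < lagr G x.
  apply: (ex_min H G'T G'm y0 _ q_k yq); first by apply: (ex_move_sum H); exact: (ex_lt H).
  move=> i ki; rewrite /y /move_weight (ex_zero H) // !gtn_eqF //=; [|lia|lia].
  by ring.
have lagrE : lagr G' y = lagr G y + \sum_(e in A) \prod_(i in e) y i.
  rewrite /lagr /lagrangian_poly.
  transitivity (\sum_(e in [predU (G :\: D)%SET & A]) \prod_(i in e) (\row_(i < n) y i) 0 i).
    by apply: eq_bigl => e; rewrite inE.
  rewrite bigU //=.
  rewrite [in RHS](big_setID D) /= [X in _ = X + _ + _]big1 => [|e]; last first.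
    by move=> /setIP[_]; rewrite inE => /andP[_ qe]; rewrite (bigD1 (Ordinal q_n)) //= mxE yq mul0r.
  by rewrite add0r; congr (_ + _); apply: eq_bigr => e _; apply: eq_bigr => i _; rewrite mxE.
(* A triple among the first T + 1 vertices has an element at most T - 2, and its other two elements
   weigh at least [x q]. *)
have sumA : #|D|%:R * (x (T - 2)%N * x q ^+ 2) <= \sum_(e in A) \prod_(i in e) y i.
  rewrite -Ad mulr_natl -sumr_const; apply: ler_sum => e /(fintype.subsetP AM).
  rewrite !inE => /andP[_ /andP[/eqP e3 /forall_inP eT]].
  have [i [j [l [ijl ln eE]]]] := tripleP e3.
  have lT : (l < T.+1)%N by apply: (eT (Ordinal ln)); rewrite eE !inE eqxx !orbT.
  have [iT2 iq jq lq] : [/\ (i <= T - 2)%N, (i < q)%N, (j < q)%N & (l < q)%N].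
    by clear -ijl lT Tk; rewrite /q; split; lia.
  have [jQ lQ] : (j <= q)%N /\ (l <= q)%N by split; exact: ltnW.
  rewrite eE (@big_triple _ 1 *%R n y); [|lia|lia|exact: ln|by rewrite -/(distinct3 i j l) distinct3E; lia].
  have big v p : (v < q)%N -> (v <= p)%N -> x p <= y v.
    by move=> vq vp; apply: le_trans (yx _ vq); exact: (ex_mono H).
  have xT := ex_ge0 H (T - 2).
  rewrite expr2; apply: ler_pM => //; first by rewrite mulr_ge0 // ltW.
    exact: big.
  by apply: ler_pM; [exact: ltW|exact: ltW|exact: big|exact: big].
have := tri_move (adj12 G) (adj23 G) (ex_irr H) (x q) x (ex_lt H r_k) q_n.
rewrite (link_eq H r_k q_k) subrr mulr0 addr0 -/y !tri_lagr ?(ex_sub H) // -/g => e6.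
have : #|D|%:R * (x (T - 2)%N * x q ^+ 2) < x q ^+ 2 * colink n g r q x by lra.
by rewrite mulrA mulrC ltr_pM2l // exprn_gt0.
Qed.

(** Cancelling b between [far_card], [far_swap] and [far_colink] shows that the k - T + 2 vertices
    from T - 2 on weigh less than vertex 0, which [far_alg] refutes. *)
Lemma far_absurd : False.
Proof.
have [b /andP[b0 bT] gb] := far_codegree.
have T4 : (3 < T)%N by lia.
pose a := x 0%N; pose xi := x (T - 2)%N.
have b0R : 0 < b%:R :> R by rewrite ltr0n.
have xi0 : 0 <= xi by exact: (ex_ge0 H).
have tail_lt : (k - T + 2)%:R * xi < a.
  rewrite -(ltr_pM2l b0R); apply: le_lt_trans (lt_le_trans far_swap (far_colink bT gb)).
  by rewrite mulrA -natrM ler_wpM2r // ler_nat; exact: far_card.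
have a0 : 0 < a by apply: (ex_pos H); lia.
pose t := \sum_(i < k - T + 2) x (T - 2 + i)%N.
have t_le : t <= (k - T + 2)%:R * xi.
  rewrite /t mulr_natl -[X in _ *+ X]card_ord -sumr_const; apply: ler_sum => i _.
  by apply: (ex_mono H); rewrite leq_addr.
have sumE : \sum_(i < T - 3) x i.+1 = 1 - a - t.
  have := ex_sum H; rewrite (sum_trunc (ex_dim H) (ex_zero H)).
  have -> : k = ((T - 3).+1 + (k - T + 2))%N by lia.
  rewrite big_split_ord /= big_ord_recl /= -/a.
  have -> : (T - 3).+1 = (T - 2)%N by lia.
  by rewrite -/t => <-; rewrite /bump /=; ring.
pose s := T%:R - 1 : R.
have sT : (T - 3)%:R = s - 2 by rewrite natrB ?/s; [ring|lia].
have s0 : 0 < s by rewrite /s subr_gt0 ltr1n; lia.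
have T0 : (0 < k)%N by lia.
have k2 : (2 < k)%N by lia.
apply: (@far_alg R s a t (tri n g x x x)).
- have [T_eq|T5] : T = 4%N \/ (5 <= T)%N by lia.
    by left; rewrite /s T_eq; lra.
  right; have : (5 : R) <= T%:R by rewrite ler_nat.
  by rewrite /s; lra.
- rewrite ltW //= -(ex_sum H); apply: (@le_sum_term R n x 0); last exact: (ex_ge0 H).
  exact: (ex_lt H).
- have : \sum_(i < T - 3) x i.+1 <= (s - 2) * a.
    rewrite -sT mulr_natl -[X in _ *+ X]card_ord -sumr_const; apply: ler_sum => i _.
    exact: (ex_mono H).
  by rewrite sumE; lra.
- exact: le_lt_trans t_le tail_lt.
(* Squares are bounded below by their tangent at 1/s, for the T - 3 = s - 2 vertices from 1 to T -
   3. *)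
- have sq : 2 * s * (1 - a - t) - (s - 2) <= s ^+ 2 * \sum_(i < T - 3) x i.+1 ^+ 2.
    rewrite -sumE mulr_sumr -sT.
    have -> : (T - 3)%:R = \sum_(i < T - 3) (1 : R) by rewrite sumr_const card_ord.
    rewrite -sumrB mulr_sumr; apply: ler_sum => i _.
    have := sqr_ge0 (s * x i.+1 - 1); lra.
  have sq2 : a ^+ 2 + \sum_(i < T - 3) x i.+1 ^+ 2 <= \sum_(j < n) x j ^+ 2.
    have -> : a ^+ 2 + \sum_(i < T - 3) x i.+1 ^+ 2 = \sum_(i < (T - 3).+1) x i ^+ 2.
      by rewrite big_ord_recl.
    by apply: (@sum_le_trunc R (T - 3).+1 n (fun i => x i ^+ 2)) => [|i]; [lia|exact: sqr_ge0].
  rewrite /g -(link_tri H T0) (link0 H) // -/a.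
  have := ler_wpM2l (sqr_ge0 s) sq2; lra.
- rewrite /g -(link_tri H T0) (link0 H) // -/a.
  have := @le_sum_term R n (fun l => x l ^+ 2) 0 (ex_lt H T0) (fun i => sqr_ge0 _).
  by rewrite -/a; lra.
have -> : s + 1 = T%:R by rewrite /s; ring.
have -> : s * (s - 1) = (T%:R - 1) * (T%:R - 2) by rewrite /s; ring.
by apply: (tri_gt H) => //; lia.
Qed.

End Far.

(** * Comparison with C_{3,m} and conclusion *)

(** The triples below T form an initial segment of colex order, so each has rank below C(T, 3). *)
Lemma clique_C3 m T : (T <= m.+2)%N -> ('C(T, 3) <= m)%N -> clique m.+2 T \subset C3 m.
Proof.
move=> Tm Cm; apply/fintype.subsetP => e eK; rewrite inE (fintype.subsetP (clique_sub _ _) _ eK) /=.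
apply: leq_trans Cm; rewrite -(card_clique Tm) /colex_rank; apply/proper_card/properP.
split; last by exists e; rewrite // inE colex_lt_irr andbF.
apply/fintype.subsetP => A; rewrite !inE => /andP[-> /colex_ltP[i [ie _ iE]]] /=.
move: eK; rewrite !inE => /andP[_ /forall_inP eT]; apply/forall_inP => v vA.
have [iv|vi] := ltnP i v; first by rewrite iE // in vA; exact: eT.
exact: leq_ltn_trans vi (eT _ ie).
Qed.

(** The vertex sets may differ: weights vanish from [k] on, so the same weighting is read on [m.+2]
    vertices and only adjacency below [k] matters. *)
Lemma lagr_le_C3 (R : realType) n m k (G : {set {set 'I_n}}) (x : nat -> R) :
  G \subset triples n -> (k <= n)%N -> (k <= m.+2)%N ->
  (forall i, 0 <= x i) -> (forall i, (k <= i)%N -> x i = 0) -> \sum_(i < n) x i = 1 ->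
  (forall i j l, (i < k)%N -> (j < k)%N -> (l < k)%N -> adj G i j l -> adj (C3 m) i j l) ->
  lagr G x <= lagrangian R (C3 m).
Proof.
move=> GT kn km x0 xk x1 GC.
have C3T : C3 m \subset triples m.+2 by apply/fintype.subsetP => e; rewrite inE => /andP[].
have [z _ [<- zmax]] := lagrangian_max R (C3 m) (ltn0Sn m.+1).
apply: le_trans (zmax (\row_i x i) _); last first.
  split=> [i|]; first by rewrite mxE.
  by under eq_bigr do rewrite mxE; rewrite (sum_trunc km xk) -(sum_trunc kn xk).
rewrite -/(lagr (C3 m) x) -(@ler_pM2l _ 6) // -!tri_lagr //.
rewrite !(tri_trunc _ _ xk) //; apply: ler_sum => i _; apply: ler_sum => j _; apply: ler_sum => l _.
rewrite ler_wpM2r ?mulr_ge0 // ler_nat; have := GC i j l (ltn_ord i) (ltn_ord j) (ltn_ord l).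
by case: (adj G i j l) => // ->.
Qed.

Lemma triple_neq n v i j l i' j' l' : (v < n)%N -> v \in [:: i; j; l] ->
  v \notin [:: i'; j'; l'] -> triple n i j l != triple n i' j' l'.
Proof.
by move=> vn vi; apply: contraNneq => /setP /(_ (Ordinal vn)); rewrite inE [in RHS]inE vi.
Qed.

Lemma four_edges n (G : {set {set 'I_n}}) i j l : (3 < n)%N -> 
  adj G 0 1 2 -> adj G 0 1 3 -> adj G 0 2 3 -> adj G i j l ->
  triple n 0 1 2 != triple n i j l -> triple n 0 1 3 != triple n i j l -> triple n 0 2 3 != triple n i j l ->
  (3 < #|G|)%N.
Proof.
move=> n4 g1 g2 g3 g4 h1 h2 h3.
have un : uniq [:: triple n 0 1 2; triple n 0 1 3; triple n 0 2 3; triple n i j l].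
  rewrite /= !inE !negb_or h1 h2 h3.
  by rewrite (@triple_neq n 2) ?(@triple_neq n 1) //; lia.
rewrite cardE; apply: (uniq_leq_size un) => e; rewrite mem_enum !inE.
by case/or4P => /eqP ->.
Qed.

(** Whatever precedes 012, 013 or 023 lies in the clique on four vertices, differs from the triple
    itself and is not 123; this leaves at most two triples. *)
Lemma C3_3 j l : (0 < j < l)%N -> (l < 4)%N -> adj (C3 3) 0 j l.
Proof.
move=> jl l4; have K : triple 5 0 j l \in clique 5 4.
  by rewrite -/(adj _ _ _ _) adj_clique // distinct3E; lia.
rewrite /adj inE (fintype.subsetP (clique_sub _ _) _ K) /=.
have K' : triple 5 1 2 3 \in clique 5 4 by rewrite -/(adj _ _ _ _) adj_clique.
have KK' : triple 5 1 2 3 \in (clique 5 4 :\ triple 5 0 j l)%SET.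
  rewrite in_setD1 K' andbT eq_sym; apply: (@triple_neq 5 0) => //.
have c4 := card_clique (isT : (4 <= 5)%N).
have := cardsD1 (triple 5 0 j l) (clique 5 4); have := cardsD1 (triple 5 1 2 3) (clique 5 4 :\ triple 5 0 j l)%SET.
rewrite K KK' c4 => d1 d2.
have c2 : #|(clique 5 4 :\ triple 5 0 j l :\ triple 5 1 2 3)%SET| = 2%N.
  by move: d2; rewrite d1 (_ : 'C(4, 3) = 4%N) // => -[].
suff : (colex_rank (triple 5 0 j l) <= 2)%N by [].
apply: leq_trans (eq_leq c2); apply: subset_leq_card; apply/fintype.subsetP => A.
rewrite !inE => /andP[A3 /colex_ltP[i [ie iA iE]]]; rewrite A3 /=; apply/and3P; split.
(* If 123 preceded {0, j, l}, the deciding vertex would be 0, and agreement above it would put 1, 2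
   and 3 into {0, j, l}. *)
- apply/eqP => AE; rewrite AE in iA ie iE.
  have i0 : (i : nat) = 0%N by move: iA ie; rewrite !inE /=; lia.
  have mem u : (0 < u < 4)%N -> u \in [:: 0; j; l]%N.
    move=> u4; have u5 : (u < 5)%N by lia.
    have u0 : (i < Ordinal u5)%N by rewrite i0 /=; lia.
    by have := iE _ u0; rewrite !inE /=; lia.
  by have := mem 1%N isT; have := mem 2%N isT; have := mem 3%N isT; rewrite !inE; lia.
- by apply: contraNneq iA => ->.
apply/forall_inP => v vA; have [iv|vi] := ltnP i v.
  by move: vA; rewrite iE // !inE /=; lia.
by apply: leq_ltn_trans vi _; move: ie; rewrite !inE /=; lia.
Qed.

Lemma bin3_ge m : (m <= 'C(m.+2, 3))%N.
Proof.
elim: m => // m IHm.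
by rewrite (binS m.+2 2) -[in leqLHS]addn1 (leq_add IHm) // bin_gt0.
Qed.

Theorem theorem5p1 (R : realType) (m t : nat)
    (m_gt0 : (0 < m)%N) (t_gt0 : (0 < t)%N)
    (m_lower : ('C(t - 1, 3) <= m)%N)
    (m_upper : (m%:Z <= 'C(t - 1, 3)%:Z + 'C(t - 2, 2)%:Z - (t%:Z - 4%:Z))%R)
    (n : nat) (G : {set {set 'I_n}})
    (G_3graph : G \subset triples n) (G_card : #|G| = m) :
  (lagrangian R G <= lagrangian R (C3 m))%R.
Proof.
have n_gt0 : (0 < n)%N.
  rewrite lt0n; apply: contraTneq m_gt0 => n0; rewrite -leqNgt -G_card.
  by apply: leq_trans (subset_leq_card G_3graph) _; rewrite card_triples n0.
have [E [k [x [H le_E]]]] := extremal_exists R n_gt0 G_3graph (eq_leq G_card).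
apply: le_trans le_E _.
have to_C3 T : (k <= T)%N -> (T <= m.+2)%N -> ('C(T, 3) <= m)%N -> lagr E x <= lagrangian R (C3 m).
  move=> kT Tm Cm.
  apply: (lagr_le_C3 (ex_sub H) (ex_dim H) (leq_trans kT Tm) (ex_ge0 H) (ex_zero H) (ex_sum H)).
  move=> i j l ik jk lk /(ex_distinct3 H) un; apply: (fintype.subsetP (clique_C3 Tm Cm)).
  by rewrite -/(adj _ _ _ _) adj_clique // un !(leq_trans _ kT).
(* For t <= 3 both binomial coefficients vanish and m <= 3. If k >= 4, the graph contains 012, 013
   and 023, hence nothing else. *)
have [t3|t4] := leqP t 3.
  have m3 : (m <= 3)%N.
    by move: m_upper; rewrite !bin_small; lia.
  have [k3|k4] := leqP k 3; first by apply: (to_C3 3%N) => //; lia.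
  have [g1 [g2 g3]] : adj E 0 1 2 /\ adj E 0 1 3 /\ adj E 0 2 3.
    by split; [|split]; apply: (adj0 H) => //; lia.
  have n3 : (3 < n)%N by apply: (ex_lt H).
  have four i j l : adj E i j l -> triple n 0 1 2 != triple n i j l ->
      triple n 0 1 3 != triple n i j l -> triple n 0 2 3 != triple n i j l -> False.
    move=> g4 h1 h2 h3; have := four_edges n3 g1 g2 g3 g4 h1 h2 h3.
    by have := ex_card H; lia.
  have m_eq : m = 3%N.
    apply/eqP; rewrite eqn_leq m3 /=; apply: leq_trans (ex_card H); rewrite cardE.
    have un : uniq [:: triple n 0 1 2; triple n 0 1 3; triple n 0 2 3].
      by rewrite /= !inE !negb_or (@triple_neq n 2) ?(@triple_neq n 1) //; lia.
    by apply: (uniq_leq_size un) => e; rewrite mem_enum !inE => /or3P[] /eqP ->.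
  have k_eq : k = 4%N.
    apply/eqP; rewrite eqn_leq k4 andbT leqNgt; apply/negP => k5.
    have n4 : (4 < n)%N by apply: (ex_lt H).
    by apply: (four 0 1 4)%N; [apply: (adj0 H)|rewrite eq_sym; apply: (@triple_neq n 4)..].
  apply: (lagr_le_C3 (ex_sub H) (ex_dim H) _ (ex_ge0 H) (ex_zero H) (ex_sum H)); first by lia.
  rewrite m_eq k_eq => i j l i4 j4 l4 gE.
  have un := ex_distinct3 H gE; move: (un); rewrite distinct3E => /and3P[ij il jl].
  have zero u v : (0 < u < 4)%N -> (0 < v < 4)%N -> u != v -> adj (C3 3) 0 u v.
    move=> u4 v4 uv; have [uv'|vu'] := ltnP u v; first by apply: C3_3; lia.
    by rewrite adj23; apply: C3_3; lia.
  have [i0|[j0|[l0|ijl]]] : i = 0%N \/ j = 0%N \/ l = 0%N \/ (0 < i)%N /\ (0 < j)%N /\ (0 < l)%N by lia.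
  - by rewrite i0; apply: zero; lia.
  - by rewrite j0 adj12; apply: zero; lia.
  - by rewrite l0 adj23 adj12; apply: zero; lia.
  have in3 v : (0 < v < 4)%N -> v \in [:: i; j; l] by rewrite !inE; lia.
  case: (four i j l gE).
  - by rewrite eq_sym; apply: (@triple_neq n 3) => //; exact: in3.
  - by rewrite eq_sym; apply: (@triple_neq n 2) => //; [lia|exact: in3].
  - by rewrite eq_sym; apply: (@triple_neq n 1) => //; [lia|exact: in3].
pose T := (t - 1)%N; rewrite -/T in m_lower m_upper.
have T3 : (2 < T)%N by rewrite /T; lia.
(* By Pascal's rule the upper bound on m says that at least 2T - 4 triples of the first T + 1
   vertices cannot be edges. *)
have mT : (m + 2 * T <= 'C(T.+1, 3) + 4)%N.
  have -> : 'C(T.+1, 3) = ('C(T, 3) + ('C(t - 2, 2) + (T - 1)))%N.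
    rewrite binS; congr addn; rewrite (_ : T = (t - 2).+1) ?binS ?bin1 /T; lia.
  by move: m_upper; rewrite /T; lia.
have Tm : (T <= m.+2)%N.
  by have := bin3_ge (T - 2); rewrite (_ : (T - 2).+2 = T); lia.
have [kT|kT] := leqP k T; first exact: to_C3 kT Tm m_lower.
have [kT1|kT1] := ltnP T.+1 k; first by case: (far_absurd H T3 kT1 m_lower mT).
have k_eq : k = (T - 1).+2 by lia.
rewrite k_eq in H; case: (succ_absurd H); first by lia.
  by rewrite (_ : (T - 1).+1 = T) //; lia.
have T1 : T%:R = (T - 1)%:R + 1 :> R by rewrite natr1; congr (_%:R); lia.
have h : (6 * m + 12 * T <= T.+1 * T * (T - 1) + 24)%N.
  have : ('C(T.+1, 3) * 6 = T.+1 * T * (T - 1))%N.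
    by rewrite (bin_ffact T.+1 3) !ffactnS ffactn0 muln1 /= -subn1 mulnA.
  by move: mT; lia.
move: h; rewrite -(ler_nat R) !natrD !natrM -natr1 T1; lra.
Qed.
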